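(* Let $\mathcal{C}$ be a family of curves in $\mathbb{D}^2\cup\partial\mathbb{D}^2$ satisfying (C1), (C2) and (C3), let $P\subset\mathbb{D}^2$ be a convex polygon (with respect to $\mathcal{C}$), and let $d$ be the metric on $P$ constructed from a set $\Theta=\{\theta_i\}_{i\in\mathbb{N}}$ and weights $(w_i)_{i\in\mathbb{N}}$ as described in the context. Then $(P,d)$ is a geodesic metric space whose geodesics are precisely the curves $\{c\cap P \mid c\in\mathcal{C},\ c\cap P\neq\emptyset\}$. In particular, $(P,d)$ is uniquely geodesic.
   Context: $\mathbb{D}^2$ is the open unit disk in $\mathbb{R}^2$ and $\partial\mathbb{D}^2$ its boundary circle. $\mathcal{C}$ is a family of continuous injective maps $I\to\mathbb{D}^2\cup\partial\mathbb{D}^2$, $I$ a closed interval of $\mathbb{R}$, with the endpoints of $I$ mapped into $\partial\mathbb{D}^2$ and the interior of $I$ mapped into $\mathbb{D}^2$; curves are identified with their images. Properties: (C1) for any two distinct points $x,y\in\mathbb{D}^2$ there is a unique curve $c_{xy}\in\mathcal{C}$ containing both; the part of $c_{xy}$ between $x$ and $y$ is the segment $[x,y]$. (C2) for any two distinct $\xi,\eta\in\partial\mathbb{D}^2$ there is a unique curve in $\mathcal{C}$ with endpoints $\xi,\eta$, called the line $(\xi,\eta)$. (C3) for any $x\in\mathbb{D}^2$, $\xi\in\partial\mathbb{D}^2$ there is a unique curve $c_{x\xi}\in\mathcal{C}$ containing $x$ and having $\xi$ as one endpoint. A set $X\subset\mathbb{D}^2$ is convex if $[x,y]\subset X$ for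 all $x,y\in X$. A convex polygon is a nonempty open convex subset $P\subset\mathbb{D}^2$ whose boundary $\partial P$ (in $\mathbb{R}^2$) is a finite union of segments (the sides of $P$). Projections: for $x\in\mathbb{D}^2$, $\theta\in\partial\mathbb{D}^2$, $x_\theta\in\partial\mathbb{D}^2$ denotes the endpoint of $c_{x\theta}$ other than $\theta$. For each $\theta\in\partial\mathbb{D}^2$ there are unique points $\xi_\theta=g_1(\theta)$, $\eta_\theta=g_2(\theta)$ in $\partial\mathbb{D}^2$ such that the region bounded by the lines $(\theta,\xi_\theta)$, $(\theta,\eta_\theta)$ and the arc of $\partial\mathbb{D}^2$ from $\xi_\theta$ to $\eta_\theta$ not containing $\theta$ contains $P$ and is minimal with this property; they are labelled so that $\theta,\eta_\theta,\xi_\theta$ are in clockwise cyclic order. Pseudo-metrics: for points $a,b$ in the arc between $\eta_\theta$ and $\xi_\theta$ not containing $\theta$, $|ab|$ is the Euclidean length of the subarc between $a$ and $b$ not containing $\theta$. For $x,y\in P$, named so that the clockwise order is $\eta_\theta,y_\theta,x_\theta,\xi_\theta$ (with $x_\theta=y_\theta$ allowed), $$d_\theta(x,y):=\log\frac{|\eta_\theta x_\theta|\,|\xi_\theta y_\theta|}{|\eta_\theta y_\theta|\,|\xi_\theta x_\theta|}.$$ Metric: $\Theta=\{\theta_i\mid i\in\mathbb{N}\}$ is a countable dense subset of $\partial\mathbb{D}^2$ such that for each side $[v,w]$ of $P$ both endpoints of $c_{vw}$ belong to $\Theta$; $w_i>0$ are reals with $\sum_i w_i<\infty$; and $d(x,y):=\sum_{i=1}^\infty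 w_i\,d_{\theta_i}(x,y)$ for $x,y\in P$ (the series converges and $d$ is a metric). ''Geodesic'' means the image of an isometric map $\mathbb{R}\to P$. A metric space is geodesic if any two points are joined by a geodesic segment (isometric image of a compact interval), and uniquely geodesic if this segment is unique. *)

(* Defs.v *)
From HB Require Import structures.
From mathcomp Require Import all_boot all_order all_algebra.
From mathcomp Require Import all_classical all_reals all_analysis.
Set Implicit Arguments.
Unset Strict Implicit.
Unset Printing Implicit Defensive.
Import Order.TTheory GRing.Theory Num.Theory.
Import numFieldNormedType.Exports.
Local Open Scope classical_set_scope.
Local Open Scope ring_scope.

Section Defs.
Context {R : realType}.
Local Notation plane := (R * R)%type.

Definition disk : set plane := [set x | x.1 ^+ 2 + x.2 ^+ 2 < 1].
Definition circle : set plane := [set x | x.1 ^+ 2 + x.2 ^+ 2 = 1].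

(* Curves are identified with their images: [c] is a set of points, and [g] on
   [a, b] is one of its parametrizations. *)
Definition parametrizes (g : R -> plane) (a b : R) (c : set plane) : Prop :=
  [/\ a < b, {within `[a, b], continuous g}, {in `[a, b] &, injective g},
      circle (g a) /\ circle (g b)
    & (forall t, t \in `]a, b[ -> disk (g t)) /\ c = g @` `[a, b]].

Definition is_curve (c : set plane) : Prop := exists g a b, parametrizes g a b c.

Definition has_endpoints (c : set plane) (xi eta : plane) : Prop :=
  exists g a b, [/\ parametrizes g a b c, g a = xi & g b = eta].

Definition has_endpoint (c : set plane) (xi : plane) : Prop :=
  exists eta, has_endpoints c xi eta.

Definition C1 (C : set (set plane)) : Prop :=
  forall x y, disk x -> disk y -> x <> y -> exists! c, [/\ C c, c x & c y].
Definition C2 (C : set (set plane)) : Prop :=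
  forall xi eta, circle xi -> circle eta -> xi <> eta ->
    exists! c, C c /\ has_endpoints c xi eta.
Definition C3 (C : set (set plane)) : Prop :=
  forall x xi, disk x -> circle xi -> exists! c, [/\ C c, c x & has_endpoint c xi].

Definition curve_family (C : set (set plane)) : Prop :=
  [/\ forall c, C c -> is_curve c, C1 C, C2 C & C3 C].

(* [x, y], the part between x and y of the curve of C through x and y; this
   gives [x, x] = {x} for x in the disk. *)
Definition seg (C : set (set plane)) (x y : plane) : set plane :=
  [set z | exists c g a b s t u,
     [/\ C c, parametrizes g a b c,
         [/\ s \in `[a, b], t \in `[a, b] & u \in `[Num.min s t, Num.max s t]]
       & [/\ g s = x, g t = y & g u = z]]].

Definition curve_convex (C : set (set plane)) (X : set plane) : Prop :=
  forall x y, X x -> X y -> seg C x y `<=` X.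

Definition boundary (X : set plane) : set plane := closure X `\` interior X.

(* [sides] lists the pairs (v, w) such that the [v, w] are the sides of P. *)
Definition convex_polygon (C : set (set plane)) (P : set plane)
    (sides : seq (plane * plane)) : Prop :=
  [/\ P !=set0, P `<=` disk, open P, curve_convex C P
    & (forall e, e \in sides -> [/\ disk e.1, disk e.2 & e.1 <> e.2]) /\
      boundary P = [set z | exists2 e, e \in sides & seg C e.1 e.2 z]].

(* x_theta *)
Definition proj (C : set (set plane)) (theta x : plane) : plane :=
  get [set xi | exists2 c, C c & c x /\ has_endpoints c theta xi].

(* The line (xi, eta) *)
Definition cline (C : set (set plane)) (xi eta : plane) : set plane :=
  get [set c | C c /\ has_endpoints c xi eta].

Definition cw_rot (t : R) (x : plane) : plane :=
  (x.1 * cos t + x.2 * sin t, - x.1 * sin t + x.2 * cos t).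

(* For theta and a on the circle: the length in [0, 2 pi[ of the arc travelled
   when going clockwise from theta to a. *)
Definition cw (theta a : plane) : R :=
  get [set t | 0 <= t < 2 * pi /\ a = cw_rot t theta].

(* For a, b on the circle and distinct from theta: the arc between a and b not
   containing theta, and its length |ab|. *)
Definition arc (theta a b : plane) : set plane :=
  [set z | circle z /\
     Num.min (cw theta a) (cw theta b) <= cw theta z
       <= Num.max (cw theta a) (cw theta b)].
Definition arc_length (theta a b : plane) : R := `|cw theta a - cw theta b|.

(* The region bounded by a closed curve J: the union of the bounded components
   of the complement of J. *)
Definition inside (J : set plane) : set plane :=
  [set z | (~` J) z /\ bounded_set (connected_component (~` J) z)].

Definition region (C : set (set plane)) (theta xi eta : plane) : set plane :=
  inside (cline C theta xi `|` cline C theta eta `|` arc theta xi eta).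

(* xi = xi_theta and eta = eta_theta; the condition on [cw] says that theta, eta,
   xi are in clockwise cyclic order. *)
Definition supporting (C : set (set plane)) (P : set plane)
    (theta xi eta : plane) : Prop :=
  [/\ [/\ circle xi, circle eta & 0 < cw theta eta < cw theta xi],
      P `<=` region C theta xi eta
    & forall xi' eta', circle xi' -> circle eta' ->
        xi' <> theta -> eta' <> theta ->
        P `<=` region C theta xi' eta' ->
        region C theta xi' eta' `<=` region C theta xi eta ->
        region C theta xi' eta' = region C theta xi eta].

Definition g1 (C : set (set plane)) (P : set plane) (theta : plane) : plane :=
  (get [set p : plane * plane | supporting C P theta p.1 p.2]).1.
Definition g2 (C : set (set plane)) (P : set plane) (theta : plane) : plane :=
  (get [set p : plane * plane | supporting C P theta p.1 p.2]).2.

(* The pseudo-metric d_theta, for projections a = x_theta and b = y_theta such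
   that eta_theta, b, a, xi_theta is the clockwise order *)
Definition log_ratio (theta xi eta a b : plane) : R :=
  ln ((arc_length theta eta a * arc_length theta xi b) /
      (arc_length theta eta b * arc_length theta xi a)).

Definition dtheta (C : set (set plane)) (P : set plane) (theta x y : plane) : R :=
  let xi := g1 C P theta in
  let eta := g2 C P theta in
  let xt := proj C theta x in
  let yt := proj C theta y in
  if cw theta yt <= cw theta xt then log_ratio theta xi eta xt yt
  else log_ratio theta xi eta yt xt.

(* theta enumerates Theta. *)
Definition admissible_directions (C : set (set plane))
    (sides : seq (plane * plane)) (theta : nat -> plane) : Prop :=
  [/\ forall i, circle (theta i), circle `<=` closure (range theta)
    & forall e c xi, e \in sides -> C c -> c e.1 -> c e.2 ->
        has_endpoint c xi -> range theta xi].

Definition admissible_weights (w : nat -> R) : Prop :=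
  (forall i, 0 < w i) /\ cvgn (series w).

Definition dterm (C : set (set plane)) (P : set plane) (theta : nat -> plane)
    (w : nat -> R) (x y : plane) : nat -> R :=
  fun i => w i * dtheta C P (theta i) x y.

Definition dP (C : set (set plane)) (P : set plane) (theta : nat -> plane)
    (w : nat -> R) (x y : plane) : R :=
  limn (series (dterm C P theta w x y)).

Definition is_metric_on (P : set plane) (d : plane -> plane -> R) : Prop :=
  [/\ forall x y, P x -> P y -> 0 <= d x y,
      forall x y, P x -> P y -> (d x y = 0 <-> x = y),
      forall x y, P x -> P y -> d x y = d y x
    & forall x y z, P x -> P y -> P z -> d x z <= d x y + d y z].

Definition isometric_on (P : set plane) (d : plane -> plane -> R)
    (I : set R) (f : R -> plane) : Prop :=
  (forall t, I t -> P (f t)) /\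
  (forall s t, I s -> I t -> d (f s) (f t) = `|s - t|).

Definition is_geodesic (P : set plane) (d : plane -> plane -> R)
    (S : set plane) : Prop :=
  exists2 f : R -> plane, isometric_on P d setT f & S = range f.

Definition geodesic_segment (P : set plane) (d : plane -> plane -> R)
    (x y : plane) (S : set plane) : Prop :=
  exists f a b,
    [/\ a <= b, isometric_on P d `[a, b] f, f a = x, f b = y & S = f @` `[a, b]].

Definition geodesic_space (P : set plane) (d : plane -> plane -> R) : Prop :=
  forall x y, P x -> P y -> exists S, geodesic_segment P d x y S.

Definition uniquely_geodesic (P : set plane) (d : plane -> plane -> R) : Prop :=
  forall x y, P x -> P y -> exists! S, geodesic_segment P d x y S.

End Defs.

(* Main.v *)
Require Import Defs.
From HB Require Import structures.
From mathcomp Require Import all_boot all_order all_algebra.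
From mathcomp Require Import all_classical all_reals all_analysis.
From mathcomp Require Import ring lra.
Set Implicit Arguments.
Unset Strict Implicit.
Unset Printing Implicit Defensive.
Import Order.TTheory GRing.Theory Num.Theory.
Import numFieldNormedType.Exports.
Local Open Scope classical_set_scope.
Local Open Scope ring_scope.

(** Seen from a boundary point [th], a point [z] of the disk has the coordinate
    [proj_angle th z], the clockwise angle from [th] to [z_th].  The only topological
    input is that two paths of the closed disk with interlaced endpoints meet, which
    follows from the Poincare-Miranda theorem; it makes [proj_angle th] continuous.
    By (C1)-(C3) this coordinate is constant along the curves ending at [th] and
    injective, hence strictly monotone, along all the others.  So [d_th] is the
    pullback of the metric of the line by a function which is monotone along every
    curve, and [d] is additive along the curves.  If [d] is additive on x, z, y, then
    so is every [d_{theta_i}]; letting [theta_i] tend to an endpoint of the curve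
    through x and y forces z onto this curve.  Finally a curve leaving P crosses a
    side whose endpoints belong to Theta, and there the corresponding [d_{theta_i}]
    blows up, so c `&` P is a complete line. *)

(** The sides of a line are never defined topologically: a point is on one side of the line from
    [th] to [xi] when its angle is below that of [xi]. The angle is extended to the boundary circle,
    so that a curve can be followed up to its ends; only [th] is excluded, since all the lines from
    [th] meet there.

    How the extremal angles of P vary with [th] is not analysed. As P is open, each of its points
    has points of smaller and of larger angle in P, and the comparison with these persists for
    nearby directions; compactness of the circle then bounds the logarithmic coordinates of a point
    uniformly in [th], which makes the series converge for all summable weights.

    For the blow-up at the boundary, the whole line through a side must miss P, not only the side
    itself. This needs convexity in a stronger form, for segments joining a point of P to a point of
    its closure; it is obtained by comparing angles from the end of an auxiliary curve. *)

(** * The Poincare-Miranda theorem on the unit square *)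

(* Call an edge mixed if [a] holds at its two ends and [b] at exactly one of them.
   If all cells had an even number of mixed edges, the number of mixed edges on a
   column would keep its parity from column 0, where it is 0, to column N, where it
   is odd. *)
Lemma grid_parity (N : nat) (a b : nat -> nat -> bool) :
  (forall j, a 0%N j = false) -> (forall j, a N j) ->
  (forall i, b i 0%N) -> (forall i, b i N = false) ->
  exists i j, [/\ (i < N)%N, (j < N)%N &
    let s := [:: (i, j); (i.+1, j); (i, j.+1); (i.+1, j.+1)] in
    [/\ has (fun p => ~~ a p.1 p.2) s, has (fun p => a p.1 p.2 && b p.1 p.2) s
      & has (fun p => a p.1 p.2 && ~~ b p.1 p.2) s]].
Proof.
move=> a0 aN b0 bN.
pose e i j i' j' := [&& a i j, a i' j' & b i j (+) b i' j'].
pose V i k := \big[addb/false]_(j < k) e i j i j.+1.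
pose cell i j := e i j i.+1 j (+) e i j.+1 i.+1 j.+1 (+) e i j i j.+1
  (+) e i.+1 j i.+1 j.+1.
have [[[i j] /andP[/= iN jN] cij]|nocell] :=
  pselect (exists2 p, (p.1 < N)%N && (p.2 < N)%N & cell p.1 p.2).
  (* A check of all values at the four corners. A mixed edge supplies the last two conditions; and
     if [a] held at all corners, [b] would change an even number of times around the cell. *)
  exists i, j; split => //=; move: cij; rewrite /cell /e /= {iN jN a0 aN b0 bN V}.
  case: (a i j); case: (a i.+1 j); case: (a i j.+1); case: (a i.+1 j.+1);
  case: (b i j); case: (b i.+1 j); case: (b i j.+1); case: (b i.+1 j.+1) => //=.
have cell0 i j : (i < N)%N -> (j < N)%N -> cell i j = false.
  by move=> iN jN; apply/negP => cij; apply: nocell; exists (i, j) => //=; rewrite iN.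
have VS i k : (i < N)%N -> (k <= N)%N ->
    V i.+1 k = V i k (+) e i 0%N i.+1 0%N (+) e i k i.+1 k.
  move=> iN; elim: k => [|k IH] kN; first by rewrite /V !big_ord0; case: (e _ _ _ _).
  rewrite /V !big_ord_recr /= -!/(V _ _) IH ?(ltnW kN)//.
  have := cell0 i k iN kN; rewrite /cell.
  case: (e i k i.+1 k); case: (e i k.+1 i.+1 k.+1); case: (e i k i k.+1);
  case: (e i.+1 k i.+1 k.+1); case: (V i k); case: (e i 0%N i.+1 0%N) => //.
have V0 i : (i <= N)%N -> V i N = false.
  elim: i => [|i IH] iN; first by rewrite /V big1// => j _; rewrite /e a0.
  by rewrite VS// IH ?(ltnW iN)// /e !b0 !bN !andbF.
have VN k : V N k = b N 0%N (+) b N k.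
  elim: k => [|k IH]; first by rewrite /V big_ord0 addbb.
  rewrite /V big_ord_recr /= -/(V _ _) IH /e !aN /=.
  by case: (b N 0%N); case: (b N k); case: (b N k.+1).
by have := V0 N (leqnn N); rewrite VN b0 bN.
Qed.

(** Without a common zero, compactness gives a mesh 1/N at which no point of the square is within
    1/N both of a weak sign change of F and of one of G. But the parity lemma, applied to the signs
    of F and G on the grid of this mesh, yields a cell where both functions take both signs. *)
Theorem poincare_miranda (R : realType) (F G : R * R -> R) :
  continuous F -> continuous G ->
  (forall t, 0 <= t <= 1 -> F (0, t) <= 0 <= F (1, t)) ->
  (forall s, 0 <= s <= 1 -> G (s, 1) <= 0 <= G (s, 0)) ->
  exists s t, [/\ 0 <= s <= 1, 0 <= t <= 1, F (s, t) = 0 & G (s, t) = 0].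
Proof.
move=> cF cG hF hG; apply: contrapT => nozero.
pose close (e : R) (p q : R * R) := `|p.1 - q.1| <= e /\ `|p.2 - q.2| <= e.
pose bad (H : R * R -> R) (e : R) p :=
  (exists2 q, close e p q & H q <= 0) /\ (exists2 q, close e p q & 0 <= H q).
(* H keeps its sign on a ball of radius [e] around p; half of [e] is spent on moving p, the other
   half on the mesh. *)
have good (H : R * R -> R) : continuous H -> forall p, H p != 0 ->
    \forall p' \near p & n \near \oo, ~ bad H n.+1%:R^-1 p'.
  move=> cH p Hp.
  have [e e0 sgn] : exists2 e : R, 0 < e & forall q, ball p e q -> 0 < H q * H p.
    have : \forall q \near p, 0 < H q * H p.
      have : {for p, continuous (fun q => H q * H p)}.
        by apply: cvgM; [exact: cH|exact: cvg_cst].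
      move=> /cvgr_gt; apply; rewrite -expr2 lt_neqAle sqr_ge0 andbT eq_sym.
      by rewrite sqrf_eq0.
    by move=> /nbhs_ballP[e /= e0 h]; exists e.
  have e20 : 0 < e / 2 by lra.
  exists (ball p (e / 2), [set n | n.+1%:R^-1 < e / 2]).
    split; first exact: nbhsx_ballx.
    exact: (near_infty_natSinv_lt (PosNum e20)).
  move=> [p' n] /= [[p1 p2]]; move: (n.+1%:R^-1) => k ne.
  move=> [[q [q1 q2] Hq] [r [r1 r2] Hr]].
  have bq : ball p e q.
    move: p1 p2; rewrite /ball /= /prod_ball /ball /= => p1 p2; split; rewrite /ball /=.
      by have := ler_distD p'.1 p.1 q.1; move: p1 q1 ne; lra.
    by have := ler_distD p'.2 p.2 q.2; move: p2 q2 ne; lra.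
  have br : ball p e r.
    move: p1 p2; rewrite /ball /= /prod_ball /ball /= => p1 p2; split; rewrite /ball /=.
      by have := ler_distD p'.1 p.1 r.1; move: p1 r1 ne; lra.
    by have := ler_distD p'.2 p.2 r.2; move: p2 r2 ne; lra.
  by have := sgn _ bq; have := sgn _ br; nra.
have /compact_near_coveringP cK : compact (`[0, 1]%classic `*` `[0, 1]%classic : set (R * R)).
  by apply: compact_setX; exact: segment_compact.
have [|n0 _ /(_ n0 (leqnn _)) /= hn] :=
    cK nat \oo (fun n p => ~ (bad F n.+1%:R^-1 p /\ bad G n.+1%:R^-1 p)) _.
  move=> [s t] [/= s01 t01].
  have [F0|F0] := eqVneq (F (s, t)) 0; last first.
    by have := good F cF _ F0; apply: filterS => -[? ?] /= h [].
  have [G0|G0] := eqVneq (G (s, t)) 0; last first.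
    by have := good G cG _ G0; apply: filterS => -[? ?] /= h [].
  by exfalso; apply: nozero; exists s, t; split.
set N := n0.+1 in hn; pose x (i : nat) : R := i%:R / N%:R.
have N0 : (0 : R) < N%:R by rewrite ltr0n.
have x0 : x 0%N = 0 by rewrite /x mul0r.
have xN : x N = 1 by rewrite /x divff// gt_eqF.
have x01 i : (i <= N)%N -> 0 <= x i <= 1.
  by move=> iN; rewrite /x divr_ge0 ?ler0n//= ler_pdivrMr// mul1r ler_nat.
have xS i : x i.+1 = x i + N%:R^-1 by rewrite /x -natr1 mulrDl mul1r.
(* On the edges of the grid the values are imposed, because F and G have only weak signs there; [hF]
   and [hG] ensure that the imposed values agree with weak signs. *)
pose a i j := (0 < i)%N && ((N <= i)%N || (0 <= F (x i, x (minn j N)))).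
pose b i j := (j < N)%N && ((j == 0)%N || (0 <= G (x (minn i N), x j))).
have aN j : a N j by rewrite /a leqnn.
have bN i : b i N = false by rewrite /b ltnn.
have [//|//|i [j [iN jN [h1 h2 h3]]]] := @grid_parity N a b _ aN _ bN.
have xi := x01 _ (ltnW iN); have xi1 := x01 _ iN.
have xj := x01 _ (ltnW jN); have xj1 := x01 _ jN.
apply: (hn (x i, x j)).
  by split => /=; rewrite in_itv /=.
pose corner q := [\/ q = (i, j), q = (i.+1, j), q = (i, j.+1) | q = (i.+1, j.+1)].
have hcorner (p : pred (nat * nat)) :
    has p [:: (i, j); (i.+1, j); (i, j.+1); (i.+1, j.+1)] ->
    exists2 q, corner q & p q.
  rewrite /= orbF => /or4P[] pq; [exists (i, j)|exists (i.+1, j)|exists (i, j.+1)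
    |exists (i.+1, j.+1)] => //; rewrite /corner; by [left|right;left|right;right;left|constructor].
have cclose q : corner q -> close N%:R^-1 (x i, x j) (x q.1, x q.2).
  have iN0 : 0 <= (N%:R^-1 : R) by rewrite invr_ge0 ltW.
  have c0 : `|x i - x i| <= N%:R^-1 by rewrite subrr normr0.
  have c1 : `|x i - x i.+1| <= N%:R^-1 by rewrite xS opprD addrA subrr sub0r normrN ger0_norm.
  have d0 : `|x j - x j| <= N%:R^-1 by rewrite subrr normr0.
  have d1 : `|x j - x j.+1| <= N%:R^-1 by rewrite xS opprD addrA subrr sub0r normrN ger0_norm.
  by case=> ->.
have cle q : corner q -> (q.1 <= N)%N && (q.2 <= N)%N.
  by case=> -> /=; rewrite ?iN ?jN ?(ltnW iN) ?(ltnW jN).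
have aF q : corner q -> a q.1 q.2 -> 0 <= F (x q.1, x q.2).
  move=> /cle/andP[q1 q2]; rewrite /a (minn_idPl q2) => /andP[_ /orP[Nq|//]].
  have -> : q.1 = N by apply/eqP; rewrite eqn_leq q1.
  by rewrite xN; case/andP: (hF _ (x01 _ q2)).
have naF q : corner q -> ~~ a q.1 q.2 -> F (x q.1, x q.2) <= 0.
  move=> /cle/andP[q1 q2]; rewrite /a (minn_idPl q2) negb_and -leqNgt leqn0 => /orP[/eqP->|].
    by rewrite x0; case/andP: (hF _ (x01 _ q2)).
  by rewrite negb_or -ltNge => /andP[_ /ltW].
have bG q : corner q -> b q.1 q.2 -> 0 <= G (x q.1, x q.2).
  move=> /cle/andP[q1 q2]; rewrite /b (minn_idPl q1) => /andP[_ /orP[/eqP->|//]].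
  by rewrite x0; case/andP: (hG _ (x01 _ q1)).
have nbG q : corner q -> ~~ b q.1 q.2 -> G (x q.1, x q.2) <= 0.
  move=> /cle/andP[q1 q2]; rewrite /b (minn_idPl q1) negb_and -leqNgt => /orP[Nq|].
    have -> : q.2 = N by apply/eqP; rewrite eqn_leq q2.
    by rewrite xN; case/andP: (hG _ (x01 _ q1)).
  by rewrite negb_or -ltNge => /andP[_ /ltW].
have [q1 c1 na1] := hcorner _ h1.
have [q2 c2 /andP[a2 b2]] := hcorner _ h2.
have [q3 c3 /andP[a3 b3]] := hcorner _ h3.
split; split.
- by exists (x q1.1, x q1.2); [exact: cclose|exact: naF].
- by exists (x q2.1, x q2.2); [exact: cclose|exact: aF].
- by exists (x q3.1, x q3.2); [exact: cclose|exact: nbG].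
- by exists (x q2.1, x q2.2); [exact: cclose|exact: bG].
Qed.

(** * Tangent lines, chords and crossing paths in the closed disk *)

Section PlaneGeometry.
Context {R : realType}.
Local Notation plane := (R * R)%type.
Implicit Types x y z p q : plane.

Definition dot x y : R := x.1 * y.1 + x.2 * y.2.
Definition det x y : R := x.1 * y.2 - x.2 * y.1.
Definition orient x y z : R := (y.1 - x.1) * (z.2 - x.2) - (y.2 - x.2) * (z.1 - x.1).

Definition cdisk : set plane := [set z | z.1 ^+ 2 + z.2 ^+ 2 <= 1].

Lemma circle_cdisk z : circle z -> cdisk z.
Proof. by rewrite /circle /cdisk /= => ->. Qed.

Lemma disk_cdisk z : disk z -> cdisk z.
Proof. exact: ltW. Qed.

Lemma cdiskP z : cdisk z -> disk z \/ circle z.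
Proof.
rewrite /cdisk /disk /circle /= le_eqVlt => /orP[/eqP ->|->]; by [right|left].
Qed.

Lemma disk_circle z : disk z -> ~ circle z.
Proof. by rewrite /disk /circle /= => h h'; move: h; rewrite h' ltxx. Qed.

Lemma tangent_ge0 th z : circle th -> cdisk z -> 0 <= 1 - dot th z.
Proof.
move=> cth; rewrite /circle /cdisk /dot /= in cth * => cz.
have := sqr_ge0 (th.1 - z.1); have := sqr_ge0 (th.2 - z.2); nra.
Qed.

Lemma tangent_eq0 th z : circle th -> cdisk z -> 1 - dot th z = 0 -> z = th.
Proof.
move=> cth; rewrite /circle /cdisk /dot /= in cth * => cz h.
have h1 : (th.1 - z.1) ^+ 2 + (th.2 - z.2) ^+ 2 <= 0 by nra.
have := sqr_ge0 (th.1 - z.1); have := sqr_ge0 (th.2 - z.2) => s2 s1.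
have /eqP : (th.1 - z.1) ^+ 2 = 0 by lra.
have /eqP : (th.2 - z.2) ^+ 2 = 0 by lra.
rewrite !sqrf_eq0 !subr_eq0 => /eqP e2 /eqP e1.
by rewrite [th]surjective_pairing e1 e2 -surjective_pairing.
Qed.

Lemma tangent_gt0 th z : circle th -> cdisk z -> z <> th -> 0 < 1 - dot th z.
Proof.
move=> cth cz zth; rewrite lt_neqAle tangent_ge0// andbT eq_sym.
by apply/eqP => /tangent_eq0; auto.
Qed.

Lemma continuous_fst : continuous (@fst R R).
Proof. by case=> a b; exact: cvg_fst. Qed.

Lemma continuous_snd : continuous (@snd R R).
Proof. by case=> a b; exact: cvg_snd. Qed.

Lemma continuous_dot th (f : R -> plane) :
  continuous f -> continuous (fun s => dot th (f s)).
Proof.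
move=> cf s; apply: cvgD; apply: cvgM; try exact: cvg_cst.
  by apply: cvg_comp (cf s) _; exact: cvg_fst.
by apply: cvg_comp (cf s) _; exact: cvg_snd.
Qed.

(* The zeros of [F] (resp. [G]) are the pairs seen in the same direction from
   the pole of the chord [th xi] (resp. [p q]); as the two chords cross inside the
   disk, the line joining the poles misses the disk, so two such points coincide. *)
Theorem crossing (f g : R -> plane) :
  continuous f -> continuous g ->
  (forall s, 0 <= s <= 1 -> cdisk (f s)) -> (forall t, 0 <= t <= 1 -> cdisk (g t)) ->
  circle (f 0) -> circle (f 1) -> circle (g 0) -> circle (g 1) ->
  orient (f 0) (f 1) (g 0) * orient (f 0) (f 1) (g 1) < 0 ->
  exists s t, [/\ 0 <= s <= 1, 0 <= t <= 1 & f s = g t].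
Proof.
move=> cf cg df dg; move f0 : (f 0) => th; move f1 : (f 1) => xi.
move g0 : (g 0) => p; move g1 : (g 1) => q => cth cxi cp cq hor.
pose A0 z := 1 - dot th z; pose A1 z := 1 - dot xi z.
pose B0 z := 1 - dot p z; pose B1 z := 1 - dot q z.
have A0ge z : cdisk z -> 0 <= A0 z by exact: tangent_ge0.
have A1ge z : cdisk z -> 0 <= A1 z by exact: tangent_ge0.
have B0ge z : cdisk z -> 0 <= B0 z by exact: tangent_ge0.
have B1ge z : cdisk z -> 0 <= B1 z by exact: tangent_ge0.
have tan0 z : circle z -> 1 - dot z z = 0.
  by rewrite /circle /dot /= -!expr2 => ->; rewrite subrr.
have cA th' (h : R -> plane) : continuous h -> continuous (fun s => 1 - dot th' (h s)).
  by move=> ch s; apply: cvgB; [exact: cvg_cst|exact: continuous_dot].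
have c1 (h : R -> R) : continuous h -> continuous (fun v : R * R => h v.1).
  by move=> ch v; apply: continuous_comp (ch _); exact: continuous_fst.
have c2 (h : R -> R) : continuous h -> continuous (fun v : R * R => h v.2).
  by move=> ch v; apply: continuous_comp (ch _); exact: continuous_snd.
pose F (v : R * R) := A0 (f v.1) * A1 (g v.2) - A1 (f v.1) * A0 (g v.2).
pose G (v : R * R) := B0 (f v.1) * B1 (g v.2) - B1 (f v.1) * B0 (g v.2).
have cF : continuous F.
  move=> v; apply: cvgB; apply: cvgM.
  - exact: (c1 _ (cA th f cf)).
  - exact: (c2 _ (cA xi g cg)).
  - exact: (c1 _ (cA xi f cf)).
  - exact: (c2 _ (cA th g cg)).
have cG : continuous G.
  move=> v; apply: cvgB; apply: cvgM.
  - exact: (c1 _ (cA p f cf)).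
  - exact: (c2 _ (cA q g cg)).
  - exact: (c1 _ (cA q f cf)).
  - exact: (c2 _ (cA p g cg)).
have [t t01|s s01|s [t [s01 t01 F0 G0]]] := poincare_miranda cF cG.
- rewrite /F /= f0 f1 /A0 /A1 !tan0// !mul0r sub0r subr0 oppr_le0.
  by rewrite !mulr_ge0//; apply: tangent_ge0 => //; do ?[exact: circle_cdisk|exact: dg].
- rewrite /G /= g0 g1 /B0 /B1 !tan0// !mulr0 sub0r subr0 oppr_le0.
  by rewrite !mulr_ge0//; apply: tangent_ge0 => //; do ?[exact: circle_cdisk|exact: df].
exists s, t; split => //.
move: F0 G0; rewrite /F /G /=.
have := df _ s01; have := dg _ t01; move: (f s) (g t) => x y dy dx FE GE.
pose op := orient th xi p; pose oq := orient th xi q.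
have hpq : op * oq < 0 by [].
(* An affine function vanishing at both poles (possibly at infinity): at that of [p q] by
   definition, at that of [th xi] by [KE]. It has no zero in the closed disk, because [op] and [oq]
   have opposite signs while [B0] and [B1] are non-negative and not both zero. *)
pose K z := oq * B0 z - op * B1 z.
have KE z : K z = orient th p q * A1 z - orient xi p q * A0 z.
  by rewrite /K /op /oq /A0 /A1 /B0 /B1 /dot /orient; ring.
have pq : p <> q by move=> E; move: hpq; rewrite /op /oq E; nra.
have Kn0 z : cdisk z -> K z != 0.
  move=> dz; have h0 := B0ge _ dz; have h1 := B1ge _ dz.
  have h : 0 < B0 z + B1 z.
    rewrite lt_neqAle addr_ge0// andbT; apply/eqP => E.
    have b0 : B0 z = 0 by lra.
    have b1 : B1 z = 0 by lra.
    by apply: pq; rewrite -(tangent_eq0 cp dz b0) -(tangent_eq0 cq dz b1).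
  apply/eqP; rewrite /K => E; move: hpq h0 h1 h E; move: (op) (oq) (B0 z) (B1 z).
  clear; move=> a b u v ab u0 v0 uv E.
  have e : b ^+ 2 * u + (- (a * b)) * v = 0.
    by transitivity (b * (b * u - a * v)); [ring|rewrite E mulr0].
  have b2 : 0 < b ^+ 2.
    by rewrite exprn_even_gt0//=; apply/eqP => b0; move: ab; rewrite b0 mulr0 ltxx.
  have h1 : 0 <= b ^+ 2 * u by rewrite mulr_ge0// ltW.
  have h2 : 0 <= - (a * b) * v by rewrite mulr_ge0//; lra.
  have u1 : u = 0 by apply/eqP; rewrite -(mulrI_eq0 _ (mulfI (lt0r_neq0 b2))); lra.
  have v1 : v = 0.
    apply/eqP; rewrite -(mulrI_eq0 _ (mulfI (lt0r_neq0 (_ : 0 < - (a * b))))); lra.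
  by lra.
(* Divided by K, the functions A0, A1 and B0 take the same values at x and y: projectively, both
   points lie on the same line through each pole. *)
have AK0 : A0 x * K y = A0 y * K x.
  by rewrite !KE; move: FE => /eqP; rewrite subr_eq0 => /eqP E; ring: E.
have AK1 : A1 x * K y = A1 y * K x.
  by rewrite !KE; move: FE => /eqP; rewrite subr_eq0 => /eqP E; ring: E.
have BK0 : B0 x * K y = B0 y * K x.
  by rewrite /K; move: GE => /eqP; rewrite subr_eq0 => /eqP E; ring: E.
move: (Kn0 _ dx) (Kn0 _ dy) AK0 AK1 BK0; move: (K x) (K y) => X Y X0 Y0.
rewrite /A0 /A1 /B0 /dot => e0 e1 e2.
have op0 : op != 0 by apply/eqP => E; move: hpq; rewrite E mul0r ltxx.
(* The three relations say that [dl], affine in z, vanishes at [th], [xi] and [p]. These are not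
   collinear as [op] is nonzero, so all the coefficients of [dl] vanish, which gives X = Y and x =
   y. *)
pose dl (z : plane) := (1 - (z.1 * x.1 + z.2 * x.2)) * Y - (1 - (z.1 * y.1 + z.2 * y.2)) * X.
have d0 : dl th = 0 by rewrite /dl e0 subrr.
have d1 : dl xi = 0 by rewrite /dl e1 subrr.
have d2 : dl p = 0 by rewrite /dl e2 subrr.
have v1 : op * (Y * x.1 - X * y.1) = 0.
  transitivity ((p.2 - th.2) * (dl th - dl xi) - (xi.2 - th.2) * (dl th - dl p)).
    by rewrite /op /orient /dl; ring.
  by rewrite d0 d1 d2 subrr !mulr0 subrr.
have v2 : op * (Y * x.2 - X * y.2) = 0.
  transitivity ((xi.1 - th.1) * (dl th - dl p) - (p.1 - th.1) * (dl th - dl xi)).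
    by rewrite /op /orient /dl; ring.
  by rewrite d0 d1 d2 subrr !mulr0 subrr.
have {}v1 : Y * x.1 - X * y.1 = 0.
  by move/eqP: v1; rewrite mulf_eq0 (negbTE op0) => /eqP.
have {}v2 : Y * x.2 - X * y.2 = 0.
  by move/eqP: v2; rewrite mulf_eq0 (negbTE op0) => /eqP.
have YX : Y = X.
  apply/eqP; rewrite -subr_eq0; apply/eqP.
  transitivity (dl th + th.1 * (Y * x.1 - X * y.1) + th.2 * (Y * x.2 - X * y.2)).
    by rewrite /dl; ring.
  by rewrite d0 v1 v2 !mulr0 !addr0.
move: v1 v2; rewrite YX -!mulrBr => /eqP; rewrite mulf_eq0 (negbTE X0) /= subr_eq0 => /eqP x1.
move=> /eqP; rewrite mulf_eq0 (negbTE X0) /= subr_eq0 => /eqP x2.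
by rewrite [x]surjective_pairing x1 x2 -surjective_pairing.
Qed.

End PlaneGeometry.

(** * Paths in subsets of the plane *)

Section Paths.
Context {R : realType}.
Local Notation plane := (R * R)%type.
Implicit Types x y z p q : plane.

Definition clamp (a b t : R) : R := Num.max a (Num.min b t).

Lemma clamp_continuous a b : continuous (clamp a b).
Proof.
move=> t; apply: continuous_max; first exact: cvg_cst.
by apply: continuous_min; [exact: cvg_cst|exact: cvg_id].
Qed.

Lemma clamp_itv a b t : a <= b -> a <= clamp a b t <= b.
Proof. by move=> ab; rewrite /clamp le_max lexx ge_max ab ge_min lexx. Qed.

Lemma clamp_id a b t : a <= t <= b -> clamp a b t = t.
Proof. by move=> /andP[at_ tb]; rewrite /clamp (min_idPr tb) (max_idPr at_). Qed.

Lemma clamp_le a b t : a <= b -> t <= a -> clamp a b t = a.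
Proof. by move=> ab ta; rewrite /clamp (min_idPr (le_trans ta ab)) (max_idPl ta). Qed.

Lemma clamp_ge a b t : a <= b -> b <= t -> clamp a b t = b.
Proof. by move=> ab bt; rewrite /clamp (min_idPl bt) (max_idPr ab). Qed.

(** Extends a map from a compact interval to a continuous map on the whole line, constant on each
    side, so that later arguments avoid subspace topologies. *)
Lemma continuous_clamp_within (T : topologicalType) (g : R -> T) a b : a <= b ->
  {within `[a, b], continuous g} -> continuous (g \o clamp a b).
Proof.
move=> ab /subspace_continuousP cg t.
have cab : `[a, b]%classic (clamp a b t) by rewrite /= in_itv /= clamp_itv.
apply: cvg_trans (cg _ cab) => A /= nA.
have nA' : nbhs (clamp a b t) [set x | `[a, b]%classic x -> A (g x)] := nA.
have h : nbhs t (clamp a b @^-1` [set x | `[a, b]%classic x -> A (g x)]).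
  exact: (@clamp_continuous a b t _ nA').
suff : nbhs t [set s | A (g (clamp a b s))] by [].
by apply: filterS h => s /=; apply; rewrite /= in_itv /= clamp_itv.
Qed.

Definition path_in (A : set plane) x y :=
  exists p : R -> plane, [/\ continuous p, p 0 = x, p 1 = y &
    forall t, 0 <= t <= 1 -> A (p t)].

Lemma path_in_trans A x y z : path_in A x y -> path_in A y z -> path_in A x z.
Proof.
move=> [p [cp p0 p1 pA]] [q [cq q0 q1 qA]].
(* At each time at least one of the two clamped paths rests at y, and subtracting y leaves the other
   one; as a sum, [r] is continuous without any gluing. *)
pose r (t : R) : plane := p (clamp 0 1 (2 * t)) + q (clamp 0 1 (2 * t - 1)) - y.
have le01 : (0 : R) <= 1 by exact: ler01.
have r1 t : t <= 1 / 2 -> r t = p (clamp 0 1 (2 * t)).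
  by move=> t2; rewrite /r (@clamp_le _ _ (2 * t - 1))// ?q0 ?addrK//; lra.
have r2 t : 1 / 2 <= t -> r t = q (clamp 0 1 (2 * t - 1)).
  move=> t2; rewrite /r (@clamp_ge _ _ (2 * t))// ?p1; last by lra.
  by rewrite addrC addrA addNr add0r.
exists r; split.
- have c2 : continuous (fun t : R => 2 * t).
    by move=> u; apply: cvgM; [exact: cvg_cst|exact: cvg_id].
  have ca : continuous (p \o (clamp 0 1 \o (fun t : R => 2 * t))).
    move=> u; apply: continuous_comp; last exact: cp.
    by apply: continuous_comp; [exact: c2|exact: clamp_continuous].
  have cb : continuous (q \o (clamp 0 1 \o (fun t : R => 2 * t - 1))).
    move=> u; apply: continuous_comp; last exact: cq.
    apply: continuous_comp; last exact: clamp_continuous.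
    by apply: cvgB; [exact: c2|exact: cvg_cst].
  by move=> t; exact: (cvgB (cvgD (ca t) (cb t)) (cvg_cst y)).
- by rewrite r1 ?clamp_le// ?mulr0//; lra.
- by rewrite r2 ?clamp_ge//; lra.
move=> t t01; have [h|h] := leP t (1 / 2).
  by rewrite r1//; apply: pA; exact: clamp_itv.
by rewrite r2 ?ltW//; apply: qA; exact: clamp_itv.
Qed.

Lemma path_in_sym A x y : path_in A x y -> path_in A y x.
Proof.
move=> [p [cp p0 p1 pA]]; exists (p \o (fun t => 1 - t)); split => /=.
- move=> t; apply: continuous_comp; last exact: cp.
  by apply: cvgB; [exact: cvg_cst|exact: cvg_id].
- by rewrite subr0.
- by rewrite subrr.
by move=> t t01; apply: pA; lra.
Qed.

Lemma path_in_sub (A B : set plane) x y : A `<=` B -> path_in A x y -> path_in B x y.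
Proof. by move=> AB [p [cp p0 p1 pA]]; exists p; split => // t t01; apply/AB/pA. Qed.

Lemma path_in_continuous (A : set plane) (g : R -> plane) s t : continuous g ->
  (forall u, Num.min s t <= u <= Num.max s t -> A (g u)) -> path_in A (g s) (g t).
Proof.
move=> cg gA; exists (g \o (fun u => s + u * (t - s))); split => /=.
- move=> u; apply: continuous_comp; last exact: cg.
  apply: cvgD; first exact: cvg_cst.
  by apply: cvgM; [exact: cvg_id|exact: cvg_cst].
- by rewrite mul0r addr0.
- by rewrite mul1r addrC subrK.
by move=> u u01; apply: gA; have [st|st] := leP s t; apply/andP; split; nra.
Qed.

Definition lerp x y (t : R) : plane :=
  ((1 - t) * x.1 + t * y.1, (1 - t) * x.2 + t * y.2).

Lemma path_in_lerp (A : set plane) x y : (forall t, 0 <= t <= 1 -> A (lerp x y t)) ->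
  path_in A x y.
Proof.
move=> h; exists (lerp x y); split => //.
- have cl (a b : R) : continuous (fun t : R => (1 - t) * a + t * b).
    move=> t; apply: cvgD; apply: cvgM; try exact: cvg_cst; try exact: cvg_id.
    by apply: cvgB; [exact: cvg_cst|exact: cvg_id].
  by move=> t; exact: (cvg_pair (cl _ _ t) (cl _ _ t)).
- by rewrite /lerp subr0 !mul1r !mul0r !addr0 -surjective_pairing.
- by rewrite /lerp subrr !mul1r !mul0r !add0r -surjective_pairing.
Qed.

Lemma cdisk_lerp x y t : 0 <= t <= 1 -> cdisk x -> cdisk y -> cdisk (lerp x y t).
Proof.
rewrite /cdisk /= => /andP[t0 t1] dx dy.
have h1 := sqr_ge0 (x.1 - y.1); have h2 := sqr_ge0 (x.2 - y.2).
suff : 0 <= t * (1 - t) * ((x.1 - y.1) ^+ 2 + (x.2 - y.2) ^+ 2) +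
   (1 - t) * (1 - (x.1 ^+ 2 + x.2 ^+ 2)) + t * (1 - (y.1 ^+ 2 + y.2 ^+ 2)).
  by lra.
have t1' : 0 <= 1 - t by rewrite subr_ge0.
apply: addr_ge0; first apply: addr_ge0; apply: mulr_ge0 => //; rewrite ?subr_ge0//.
  exact: mulr_ge0.
exact: addr_ge0.
Qed.

Lemma ball_lerp x y z (e t : R) : 0 <= t <= 1 -> ball z e x -> ball z e y ->
  ball z e (lerp x y t).
Proof.
move=> /andP[t0 t1] [x1 x2] [y1 y2].
have key (a b c : R) : ball a e b -> ball a e c -> ball a e ((1 - t) * b + t * c).
  rewrite /ball /= !ltr_norml => /andP[h1 h2] /andP[h3 h4].
  have t1' : 0 <= 1 - t by lra.
  have e1 : 0 <= (1 - t) * (a - b + e) by rewrite mulr_ge0//; lra.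
  have e2 : 0 <= t * (a - c + e) by rewrite mulr_ge0//; lra.
  have e3 : 0 <= (1 - t) * (e - (a - b)) by rewrite mulr_ge0//; lra.
  have e4 : 0 <= t * (e - (a - c)) by rewrite mulr_ge0//; lra.
  by apply/andP; split; nra.
by split; exact: key.
Qed.

End Paths.

(** * The clockwise angle on the circle *)

Section ClockwiseAngle.
Context {R : realType}.
Local Notation plane := (R * R)%type.
Implicit Types x y z p q th rho a b : plane.

Lemma circle_rot t th : circle th -> circle (cw_rot t th).
Proof.
rewrite /circle /cw_rot /= => h.
transitivity ((th.1 ^+ 2 + th.2 ^+ 2) * (cos t ^+ 2 + sin t ^+ 2)); first by ring.
by rewrite h cos2Dsin2 mulr1.
Qed.

Lemma cw_rotD s t th : cw_rot s (cw_rot t th) = cw_rot (s + t) th.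
Proof. by rewrite /cw_rot /= sinD cosD; congr pair; ring. Qed.

Lemma cw_rot0 th : cw_rot 0 th = th.
Proof. by rewrite /cw_rot cos0 sin0 !mulr0 !mulr1 addr0 add0r -surjective_pairing. Qed.

Lemma cw_rot2pi t th : cw_rot (t + 2 * pi) th = cw_rot t th.
Proof. by rewrite /cw_rot [2 * pi]mulrC mulr_natr sinD2pi cosD2pi. Qed.

Lemma cos_lt1 (t : R) : 0 < t < 2 * pi -> cos t < 1.
Proof.
move=> /andP[t0 t2]; have -> : t = (t / 2) *+ 2 by rewrite -mulr_natr divfK.
rewrite cos_mulr2n cos2sin2.
have : 0 < sin (t / 2) by apply: sin_gt0_pi; lra.
move=> h; have := mulr_gt0 h h; rewrite -expr2 => h'; rewrite -mulr_natr; lra.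
Qed.

Lemma cw_rot_inj th s t : circle th -> 0 <= s < 2 * pi -> 0 <= t < 2 * pi ->
  cw_rot s th = cw_rot t th -> s = t.
Proof.
move=> cth; wlog st : s t / s <= t => [wl hs ht E|].
  by have [/wl|/ltW/wl] := leP s t; [exact|move=> /(_ ht hs (esym E))].
move=> /andP[s0 s2] /andP[t0 t2] /(congr1 (cw_rot (- s))).
rewrite !cw_rotD addNr cw_rot0 => E.
move: st; rewrite le_eqVlt => /orP[/eqP//|st]; exfalso.
have h : 0 < - s + t < 2 * pi by lra.
have := cos_lt1 h.
have -> : cos (- s + t) = (th.1 ^+ 2 + th.2 ^+ 2) * cos (- s + t) by rewrite cth mul1r.
have -> : (th.1 ^+ 2 + th.2 ^+ 2) * cos (- s + t) = dot th (cw_rot (- s + t) th).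
  by rewrite /dot /cw_rot /=; ring.
by rewrite -E /dot -!expr2 cth ltxx.
Qed.

(* Stereographic projection from [th]: equal to - cot (t / 2) when [a] is at
   clockwise angle t from [th]. *)
Definition ster th a : R := det th a / (1 - dot th a).

(** A closed formula for [cw], which is only chosen by [get]; continuity in both arguments is read
    off from it. At [a = th] on the circle the quotient is 0 / 0 = 0, so the value there is the
    meaningless pi. *)
Definition acw th a : R := pi + 2 * atan (ster th a).

Lemma acw_itv th a : 0 < acw th a < 2 * pi.
Proof.
have := atan_ltpi2 (ster th a); have := atan_gtNpi2 (ster th a); rewrite /acw; lra.
Qed.

(** Lagrange's identity [det^2 + dot^2 = 1] gives [(1 + k^2) (1 - dot) = 2] for [k = ster th a]; the
    double-angle formulas then yield the cosine [dot th a] and the sine [- det th a]. *)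
Lemma acw_rot th a : circle th -> circle a -> a <> th -> a = cw_rot (acw th a) th.
Proof.
move=> cth ca ath.
have d0 := tangent_gt0 cth (circle_cdisk ca) ath.
have dn0 : 1 - dot th a != 0 by rewrite gt_eqF.
set k := ster th a; have kE : k * (1 - dot th a) = det th a by rewrite /k /ster divfK.
have lag : det th a ^+ 2 + dot th a ^+ 2 = 1.
  transitivity ((th.1 ^+ 2 + th.2 ^+ 2) * (a.1 ^+ 2 + a.2 ^+ 2)).
    by rewrite /det /dot; ring.
  by rewrite cth ca mulr1.
have k2 : (1 + k ^+ 2) * (1 - dot th a) = 2.
  apply: (mulfI dn0); rewrite -[RHS]mulrC.
  transitivity ((1 - dot th a) ^+ 2 + (k * (1 - dot th a)) ^+ 2); first by ring.
  by rewrite kE; move: lag; clear; lra.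
have ca0 : cos (atan k) != 0.
  have [h _] := atan_def k; apply: lt0r_neq0; exact: cos_gt0_pihalf.
have := cos2_tan2 ca0; rewrite atanK => c2.
have c2' : cos (atan k) ^+ 2 * (1 + k ^+ 2) = 1 by rewrite -c2 divff// sqrf_eq0.
have c2E : cos (atan k) ^+ 2 * 2 = 1 - dot th a.
  by rewrite -k2 mulrA c2' mul1r.
have sE : sin (atan k) = k * cos (atan k).
  by have := atanK k; rewrite /tan => {2}<-; rewrite divfK.
have costE : cos (acw th a) = dot th a.
  rewrite /acw -/k addrC cosDpi [2 * _]mulrC mulr_natr cos_mulr2n -mulr_natr c2E; lra.
have sintE : sin (acw th a) = - det th a.
  rewrite /acw -/k addrC sinDpi [2 * _]mulrC mulr_natr sin_mulr2n -mulr_natr sE.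
  by rewrite -kE -c2E; ring.
rewrite /cw_rot costE sintE [LHS]surjective_pairing; congr pair.
  transitivity (a.1 * (th.1 ^+ 2 + th.2 ^+ 2)); first by rewrite cth mulr1.
  by rewrite /dot /det; ring.
transitivity (a.2 * (th.1 ^+ 2 + th.2 ^+ 2)); first by rewrite cth mulr1.
by rewrite /dot /det; ring.
Qed.

Lemma cw_rotK th t : circle th -> 0 <= t < 2 * pi -> cw th (cw_rot t th) = t.
Proof.
move=> cth ht; rewrite /cw; apply: get_unique; first by split.
by move=> s [hs E]; apply: (cw_rot_inj cth) => //.
Qed.

Lemma cw_self th : circle th -> cw th th = 0.
Proof.
move=> cth; rewrite -{2}[th]cw_rot0 cw_rotK// lexx /=.
by have := @pi_gt0 R; lra.
Qed.

Lemma cwE th a : circle th -> circle a -> a <> th -> cw th a = acw th a.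
Proof.
move=> cth ca ath; rewrite {1}(acw_rot cth ca ath) cw_rotK//.
by have /andP[/ltW -> ->] := acw_itv th a.
Qed.

Lemma cw_gt0 th a : circle th -> circle a -> a <> th -> 0 < cw th a.
Proof. by move=> cth ca ath; rewrite cwE//; case/andP: (acw_itv th a). Qed.

Lemma cw_itv th a : circle th -> circle a -> 0 <= cw th a < 2 * pi.
Proof.
move=> cth ca; have [->|ath] := pselect (a = th).
  by rewrite cw_self// lexx /=; have := @pi_gt0 R; lra.
by rewrite cwE//; have /andP[/ltW -> ->] := acw_itv th a.
Qed.

Lemma cwK th a : circle th -> circle a -> cw_rot (cw th a) th = a.
Proof.
move=> cth ca; have [->|ath] := pselect (a = th); first by rewrite cw_self// cw_rot0.
by rewrite cwE// -acw_rot.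
Qed.

Lemma cw_inj th a b : circle th -> circle a -> circle b -> cw th a = cw th b -> a = b.
Proof. by move=> cth ca cb E; rewrite -(cwK cth ca) E cwK. Qed.

Lemma cw_change th rho a : circle th -> circle rho -> circle a ->
  cw rho a = if cw th rho <= cw th a then cw th a - cw th rho
             else cw th a - cw th rho + 2 * pi.
Proof.
move=> cth crho ca.
have /andP[r0 r2] := cw_itv cth crho; have /andP[a0 a2] := cw_itv cth ca.
have E : a = cw_rot (cw th a - cw th rho) rho.
  by rewrite -{2}(cwK cth crho) cw_rotD subrK cwK.
case: ifPn => h.
  by rewrite {1}E cw_rotK//; lra.
by rewrite -ltNge in h; rewrite {1}E -cw_rot2pi cw_rotK//; lra.
Qed.

Lemma cw_sym th rho : circle th -> circle rho -> rho <> th ->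
  cw rho th = 2 * pi - cw th rho.
Proof.
move=> cth crho ne; rewrite (cw_change cth crho cth) cw_self//.
by rewrite leNgt cw_gt0//=; lra.
Qed.

(** As [th] has norm 1, the orientation equals [det th xi * (1 - dot th p) - det th p * (1 - dot th
    xi)], so its sign compares stereographic coordinates. This turns an order of angles into the
    interlacing hypothesis of [crossing]. *)
Lemma orient_cw th xi p : circle th -> circle xi -> circle p -> xi <> th -> p <> th ->
  cw th p < cw th xi -> 0 < orient th xi p.
Proof.
move=> cth cxi cp xith pth; rewrite !cwE// /acw => h.
have {}h : atan (ster th p) < atan (ster th xi) by lra.
have {}h : ster th p < ster th xi.
  by rewrite ltNge; apply/negP => /le_atan; rewrite leNgt h.
have dx := tangent_gt0 cth (circle_cdisk cxi) xith.
have dp := tangent_gt0 cth (circle_cdisk cp) pth.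
move: h; rewrite /ster ltr_pdivrMr// mulrAC ltr_pdivlMr// => h.
suff : orient th xi p = det th xi * (1 - dot th p) - det th p * (1 - dot th xi).
  by move=> ->; lra.
transitivity ((th.1 ^+ 2 + th.2 ^+ 2) * (xi.1 * p.2 - xi.2 * p.1) - det th p + det th xi).
  by rewrite cth /orient /det; ring.
by rewrite /det /dot; ring.
Qed.

Lemma orient_cw_lt0 th xi p : circle th -> circle xi -> circle p -> xi <> th -> p <> th ->
  cw th xi < cw th p -> orient th xi p < 0.
Proof.
move=> cth cxi cp xith pth h.
have := orient_cw cth cp cxi pth xith h; rewrite /orient => h'; lra.
Qed.

Lemma acw_continuous (th a : plane) : 1 - dot th a != 0 ->
  {for (th, a), continuous (fun v : plane * plane => acw v.1 v.2)}.
Proof.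
move=> d0.
have c1 (v : plane * plane) : (u.1 @[u --> v] --> v.1) by case: v => x y; exact: cvg_fst.
have c2 (v : plane * plane) : (u.2 @[u --> v] --> v.2) by case: v => x y; exact: cvg_snd.
have c11 : u.1.1 @[u --> (th, a)] --> th.1.
  by apply: cvg_comp (c1 _) _; exact: continuous_fst.
have c12 : u.1.2 @[u --> (th, a)] --> th.2.
  by apply: cvg_comp (c1 _) _; exact: continuous_snd.
have c21 : u.2.1 @[u --> (th, a)] --> a.1.
  by apply: cvg_comp (c2 _) _; exact: continuous_fst.
have c22 : u.2.2 @[u --> (th, a)] --> a.2.
  by apply: cvg_comp (c2 _) _; exact: continuous_snd.
apply: cvgD; first exact: cvg_cst.
apply: cvgM; first exact: cvg_cst.
apply: (@cvg_comp _ _ _ (fun v : plane * plane => ster v.1 v.2) atan); last exact: continuous_atan.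
apply: cvgM.
  by apply: cvgB; apply: cvgM.
apply: cvgV => //; apply: cvgB; first exact: cvg_cst.
by apply: cvgD; apply: cvgM.
Qed.

End ClockwiseAngle.

(** * Curves parametrized by the unit interval and their ends *)

Section NormalizedCurves.
Context {R : realType}.
Local Notation plane := (R * R)%type.
Implicit Types (x y z p q th xi eta rho : plane) (c : set plane).

(* Parametrizations by [0, 1], extended to continuous functions on the line. *)
Definition nparam (g : R -> plane) c : Prop :=
  [/\ continuous g, {in `[0, 1] &, injective g}, circle (g 0) /\ circle (g 1),
      (forall t, 0 < t < 1 -> disk (g t)) & c = g @` `[0, 1]].

Lemma nparam_parametrizes g c : nparam g c -> parametrizes g 0 1 c.
Proof.
move=> [cg gi ge gd ->]; split => //.
exact: continuous_subspaceT.
Qed.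

Lemma parametrizes_nparam g a b c : parametrizes g a b c ->
  exists h, [/\ nparam h c, h 0 = g a & h 1 = g b].
Proof.
move=> [ab cg gi [ga gb] [gd cE]].
pose k (t : R) := a + t * (b - a).
have k0 : k 0 = a by rewrite /k mul0r addr0.
have k1 : k 1 = b by rewrite /k mul1r addrC subrK.
have kab t : 0 <= t <= 1 -> a <= k t <= b by rewrite /k => h; apply/andP; split; nra.
have hk t : 0 <= t <= 1 -> g (clamp a b (k t)) = g (k t).
  by move=> h; rewrite clamp_id// kab.
have le01 : (0 : R) <= 1 := ler01.
exists ((g \o clamp a b) \o k); split; last 2 first.
- by rewrite /= hk ?k0// lexx.
- by rewrite /= hk ?k1// lexx andbT.
split.
- move=> t; apply: continuous_comp; last exact: (continuous_clamp_within (ltW ab) cg).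
  apply: cvgD; first exact: cvg_cst.
  by apply: cvgM; [exact: cvg_id|exact: cvg_cst].
- move=> s t; rewrite !in_itv /= => hs ht; rewrite !hk// => /gi.
  rewrite !in_itv /= !kab// => /(_ isT isT); rewrite /k => /addrI.
  by apply: mulIf; rewrite subr_eq0 gt_eqF.
- by rewrite /= !hk ?k0 ?k1 ?lexx ?le01.
- move=> t h; rewrite /= hk; last by lra.
  by apply: gd; rewrite in_itv /= /k; apply/andP; split; nra.
rewrite cE; apply/seteqP; split => z [t]; rewrite /= in_itv /= => ht <-.
  have bn0 : b - a != 0 by rewrite subr_eq0 gt_eqF.
  have kt : k ((t - a) / (b - a)) = t by rewrite /k divfK// addrC subrK.
  have t01 : 0 <= (t - a) / (b - a) <= 1.
    by rewrite divr_ge0 ?ler_pdivrMr//; lra.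
  by exists ((t - a) / (b - a)); rewrite /= ?in_itv//= hk// kt.
by exists (k t); rewrite /= ?in_itv /= ?kab// hk.
Qed.

Lemma has_endpointsP c th xi :
  has_endpoints c th xi <-> exists g, [/\ nparam g c, g 0 = th & g 1 = xi].
Proof.
split; first by move=> [g [a [b [/parametrizes_nparam[h [nh h0 h1]] <- <-]]]]; exists h.
by move=> [g [/nparam_parametrizes ng g0 g1]]; exists g, 0, 1.
Qed.

Lemma nparam_mem g c t : nparam g c -> 0 <= t <= 1 -> c (g t).
Proof. by move=> [_ _ _ _ ->] h; exists t => //=; rewrite in_itv. Qed.

Lemma nparam_ex g c z : nparam g c -> c z -> exists2 t, 0 <= t <= 1 & z = g t.
Proof. by move=> [_ _ _ _ ->] [t]; rewrite /= in_itv /= => h <-; exists t. Qed.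

Lemma nparam_inj g c s t : nparam g c -> 0 <= s <= 1 -> 0 <= t <= 1 -> g s = g t -> s = t.
Proof. by move=> [_ gi _ _ _] hs ht; apply: gi; rewrite in_itv. Qed.

Lemma nparam_ends g c : nparam g c -> g 0 <> g 1.
Proof.
move=> ng /(nparam_inj ng) h; have : (0 : R) = 1 by apply: h; rewrite ?lexx ?ler01.
by move/eqP; rewrite eq_sym oner_eq0.
Qed.

Lemma nparam_cdisk g c t : nparam g c -> 0 <= t <= 1 -> cdisk (g t).
Proof.
move=> [_ _ [g0 g1] gd _] /andP[].
rewrite le_eqVlt => /orP[/eqP <- _|t0]; first exact: circle_cdisk.
rewrite le_eqVlt => /orP[/eqP ->|t1]; first exact: circle_cdisk.
by apply/disk_cdisk/gd; rewrite t0.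
Qed.

Lemma nparam_disk g c t : nparam g c -> 0 <= t <= 1 -> disk (g t) -> 0 < t < 1.
Proof.
move=> [_ _ [g0 g1] gd _] /andP[t0 t1] dt; rewrite !lt_neqAle t0 t1 !andbT.
by apply/andP; split; apply/eqP => E; move: dt g0 g1; [rewrite -E|rewrite E] => /disk_circle.
Qed.

Lemma nparam_circle g c t : nparam g c -> 0 <= t <= 1 -> circle (g t) -> t = 0 \/ t = 1.
Proof.
move=> ng /andP[t0 t1] ct.
have [->|tn0] := eqVneq t 0; first by left.
have [->|tn1] := eqVneq t 1; first by right.
have [_ _ _ gd _] := ng; exfalso; apply: (@disk_circle _ (g t)) => //.
by apply: gd; rewrite !lt_neqAle t0 t1 (eq_sym 0) tn0 tn1.
Qed.

Lemma nparam_rev g c : nparam g c -> nparam (g \o (fun t => 1 - t)) c.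
Proof.
move=> [cg gi [g0 g1] gd cE]; split.
- move=> t; apply: continuous_comp; last exact: cg.
  by apply: cvgB; [exact: cvg_cst|exact: cvg_id].
- move=> s t; rewrite !in_itv /= => hs ht /gi; rewrite !in_itv /=.
  move=> E; suff : 1 - s = 1 - t by lra.
  by apply: E; lra.
- by rewrite /= subr0 subrr.
- by move=> t h /=; apply: gd; lra.
rewrite cE; apply/seteqP; split => z [t]; rewrite /= in_itv /= => ht <-.
  by exists (1 - t); rewrite /= ?in_itv /= ?subKr//; lra.
by exists (1 - t); rewrite /= ?in_itv /=//; lra.
Qed.

Lemma has_endpoints_sym c th xi : has_endpoints c th xi -> has_endpoints c xi th.
Proof.
move=> /has_endpointsP[g [ng g0 g1]]; apply/has_endpointsP.
by exists (g \o (fun t => 1 - t)); split; [exact: nparam_rev|rewrite /= subr0|rewrite /= subrr].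
Qed.

Lemma has_endpoints_circle c th xi : has_endpoints c th xi ->
  [/\ circle th, circle xi, th <> xi, c th & c xi].
Proof.
move=> /has_endpointsP[g [ng <- <-]]; have [_ _ [g0 g1] _ _] := ng.
by split => //; [exact: nparam_ends ng|apply: nparam_mem ng _|apply: nparam_mem ng _];
  rewrite ?lexx ?ler01.
Qed.

Lemma has_endpoints_mem c th xi z : has_endpoints c th xi -> c z -> circle z ->
  z = th \/ z = xi.
Proof.
move=> /has_endpointsP[g [ng <- <-]] /(nparam_ex ng)[t ht ->] /(nparam_circle ng ht).
by case=> ->; [left|right].
Qed.

Lemma has_endpoints_uniq c th xi xi' :
  has_endpoints c th xi -> has_endpoints c th xi' -> xi' = xi.
Proof.
move=> h /has_endpoints_circle[_ cx ne _ mx].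
by have [/esym|//] := has_endpoints_mem h mx cx.
Qed.

Lemma is_curve_endpoints c : is_curve c -> exists th xi, has_endpoints c th xi.
Proof. by move=> [g [a [b h]]]; exists (g a), (g b), g, a, b. Qed.

Lemma nparam_closed g c : nparam g c -> closed c.
Proof.
move=> [cg _ _ _ ->]; apply: compact_closed; first exact: norm_hausdorff.
apply: continuous_compact; last exact: segment_compact.
exact: continuous_subspaceT.
Qed.

End NormalizedCurves.

(** * The angle of a point seen from the boundary, and its continuity *)

Section Projections.
Context {R : realType}.
Local Notation plane := (R * R)%type.
Implicit Types (x y z p q th xi eta rho : plane) (c : set plane).
Variable C : set (set plane).
Hypothesis hC : curve_family C.

Lemma curve_ends c : C c -> exists th xi, has_endpoints c th xi.
Proof. by have [cC _ _ _] := hC => /cC/is_curve_endpoints. Qed.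

Lemma curve_nparam c : C c -> exists g, nparam g c.
Proof. by move=> /curve_ends[th [xi /has_endpointsP[g [ng _ _]]]]; exists g. Qed.

Lemma curve_through x y : disk x -> disk y -> x <> y -> exists c, [/\ C c, c x & c y].
Proof. by have [_ h _ _] := hC => dx dy xy; have [c [cc _]] := h x y dx dy xy; exists c. Qed.

Lemma curve_uniq c c' x y : C c -> C c' -> disk x -> disk y -> x <> y ->
  c x -> c y -> c' x -> c' y -> c = c'.
Proof.
have [_ h _ _] := hC => Cc Cc' dx dy xy cx cy cx' cy'.
by have [d [_ du]] := h x y dx dy xy; rewrite -(du c) // -(du c').
Qed.

Lemma line_ex th xi : circle th -> circle xi -> th <> xi ->
  exists2 c, C c & has_endpoints c th xi.
Proof.
have [_ _ h _] := hC => cth cxi ne.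
by have [c [[Cc hc] _]] := h _ _ cth cxi ne; exists c.
Qed.

Lemma line_uniq c c' th xi : C c -> C c' -> has_endpoints c th xi ->
  has_endpoints c' th xi -> c = c'.
Proof.
have [_ _ h _] := hC => Cc Cc' hc hc'; have [cth cxi ne _ _] := has_endpoints_circle hc.
by have [d [_ du]] := h _ _ cth cxi ne; rewrite -(du c) // -(du c').
Qed.

Lemma clineP th xi : circle th -> circle xi -> th <> xi ->
  C (cline C th xi) /\ has_endpoints (cline C th xi) th xi.
Proof.
move=> cth cxi ne; have [c Cc hc] := line_ex cth cxi ne.
by apply: (@getPex _ [set c | C c /\ has_endpoints c th xi]); exists c.
Qed.

Lemma ray_uniq c c' x th xi xi' : C c -> C c' -> disk x -> c x -> c' x ->
  has_endpoints c th xi -> has_endpoints c' th xi' -> c = c'.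
Proof.
have [_ _ _ h] := hC => Cc Cc' dx cx cx' hc hc'.
have [cth _ _ _ _] := has_endpoints_circle hc.
have [d [_ du]] := h _ _ dx cth; transitivity d; [apply/esym/du|apply: du]; split => //.
  by exists xi.
by exists xi'.
Qed.

Lemma projP th x : circle th -> disk x ->
  exists2 c, C c & c x /\ has_endpoints c th (Defs.proj C th x).
Proof.
have [_ _ _ h] := hC => cth dx; have [c [[Cc cx [xi hxi]] _]] := h _ _ dx cth.
by apply: (@getPex _ [set xi | exists2 c, C c & c x /\ has_endpoints c th xi]); exists xi, c.
Qed.

Lemma projE th x xi c : disk x -> C c -> c x -> has_endpoints c th xi -> Defs.proj C th x = xi.
Proof.
move=> dx Cc cx hc; have [cth _ _ _ _] := has_endpoints_circle hc.
have [d Cd [dx' hd]] := projP cth dx.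
by have E := ray_uniq Cc Cd dx cx dx' hc hd; rewrite -E in hd; exact: has_endpoints_uniq hc hd.
Qed.

(** A boundary point is its own projection, so that the angle makes sense, and is continuous, up to
    the ends of a curve. *)
Definition proj_ext th z : plane := if `[< circle z >] then z else Defs.proj C th z.
Definition proj_angle th z : R := cw th (proj_ext th z).
Local Notation hh := proj_angle.
(** The point [th] is removed because every value of the angle occurs arbitrarily close to it, along
    the lines ending there. *)
Definition pdisk th : set plane := [set z | cdisk z /\ z <> th].

Lemma proj_ext_circle th z : circle z -> proj_ext th z = z.
Proof. by move=> cz; rewrite /proj_ext asboolT. Qed.

Lemma proj_ext_disk th z : disk z -> proj_ext th z = Defs.proj C th z.
Proof. by move=> dz; rewrite /proj_ext asboolF//; exact: disk_circle. Qed.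

Lemma proj_angle_circle th z : circle z -> hh th z = cw th z.
Proof. by move=> cz; rewrite /hh proj_ext_circle. Qed.

Lemma disk_pdisk th z : circle th -> disk z -> pdisk th z.
Proof.
move=> cth dz; split; first exact: disk_cdisk.
by move=> E; move: cth; rewrite -E; exact: disk_circle.
Qed.

Lemma proj_extP th z : circle th -> pdisk th z -> circle (proj_ext th z) /\ proj_ext th z <> th.
Proof.
move=> cth [/cdiskP[dz|cz] zth]; last by rewrite proj_ext_circle.
rewrite proj_ext_disk//; have [c Cc [_ /has_endpoints_circle[]]] := projP cth dz.
by move=> _ ? ne _ _; split => // /esym.
Qed.

Lemma proj_angle_itv th z : circle th -> pdisk th z -> 0 < hh th z < 2 * pi.
Proof.
move=> cth pz; have [cp pth] := proj_extP cth pz.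
by rewrite /hh cw_gt0//=; case/andP: (cw_itv cth cp).
Qed.

(** The level sets of the angle are the lines ending at [th]: a point at the angle of [xi] lies on a
    curve with ends [th] and [xi], which is c by (C2); conversely (C3) makes c the curve defining
    the projection. *)
Lemma proj_angle_line c th xi z : C c -> has_endpoints c th xi -> pdisk th z ->
  hh th z = cw th xi <-> c z.
Proof.
move=> Cc hc pz; have [cth cxi ne _ mxi] := has_endpoints_circle hc.
have [cp _] := proj_extP cth pz; split.
  move=> /(cw_inj cth cp cxi) E; case: pz => /cdiskP[dz|cz] zth; last first.
    by rewrite proj_ext_circle// in E; rewrite E.
  rewrite proj_ext_disk// in E; have [d Cd [dz' hd]] := projP cth dz.
  by rewrite E in hd; rewrite (line_uniq Cc Cd hc hd).
move=> cz; case: pz => /cdiskP[dz|cirz] zth.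
  by rewrite /hh proj_ext_disk// (projE dz Cc cz hc).
by rewrite proj_angle_circle//; have [//|->] := has_endpoints_mem hc cz cirz.
Qed.

(** The piece of the curve from z to its far end. It replaces a point of the disk by a boundary
    point, to which [crossing] applies, without changing the angle. *)
Lemma path_to_proj th z : circle th -> pdisk th z ->
  path_in (pdisk th `&` [set w | hh th w = hh th z]) z (proj_ext th z).
Proof.
move=> cth pz; case: (pz) => /cdiskP[dz|cz] zth; last first.
  rewrite proj_ext_circle//; exists (fun=> z); split => // t; exact: cvg_cst.
have [c Cc [cz hc]] := projP cth dz.
have hz : hh th z = cw th (Defs.proj C th z) by apply/(proj_angle_line Cc hc pz).
rewrite proj_ext_disk//; move: (hc) => /has_endpointsP[g [ng g0 g1]].
have [t ht zE] := nparam_ex ng cz; rewrite -g1.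
have [cg _ _ _ _] := ng.
have t01 : 0 < t < 1 by apply: nparam_disk ng ht _; rewrite -zE.
rewrite {2}zE; apply: path_in_continuous => // u.
rewrite (min_idPl _) ?(max_idPr _); do ?[by lra].
move=> /andP[tu u1].
have u01 : 0 <= u <= 1 by lra.
have pu : pdisk th (g u).
  split; first exact: nparam_cdisk ng u01.
  rewrite -g0 => /(nparam_inj ng u01) E.
  by have : u = 0 by [apply: E; rewrite lexx ler01]; lra.
split => //=; rewrite hz; apply/(proj_angle_line Cc hc pu); exact: nparam_mem ng u01.
Qed.

(* If [y] were on the other side of [c] than [z], then the pieces of lines from [z]
   to [z_th] and from [y] to [y_th] and the Euclidean segment from [z] to [y] would
   join the two sides of [c] without meeting [c]. *)
Lemma proj_angle_side_near c th xi z : C c -> has_endpoints c th xi -> pdisk th z ->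
  hh th z <> cw th xi ->
  \forall y \near z, pdisk th y -> (hh th y < cw th xi) = (hh th z < cw th xi)
    /\ hh th y <> cw th xi.
Proof.
move=> Cc hc pz hz; have [cth cxi ne _ _] := has_endpoints_circle hc.
move: (hc) => /has_endpointsP[f [nf f0 f1]].
have : nbhs z (~` c).
  apply: open_nbhs_nbhs; split; first by apply: closed_openC; exact: nparam_closed nf.
  by move=> /(proj_angle_line Cc hc pz).
move=> /nbhs_ballP[e /= e0 be]; apply/nbhs_ballP; exists e => //= y bey py.
have hy : hh th y <> cw th xi by move/(proj_angle_line Cc hc py); exact: be.
split => //.
have sub w : pdisk th w -> hh th w <> cw th xi ->
    path_in (cdisk `&` ~` c) w (proj_ext th w).
  move=> pw hw; apply: path_in_sub (path_to_proj cth pw) => v [pv /= hv].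
  by split; [case: pv|move/(proj_angle_line Cc hc pv); rewrite hv].
have mid : path_in (cdisk `&` ~` c) z y.
  apply: path_in_lerp => t ht; split.
    by apply: cdisk_lerp => //; [case: pz|case: py].
  by apply: be; apply: ball_lerp => //; exact: ballxx.
have [g [cg g0 g1 gA]] := path_in_trans (path_in_sym (sub z pz hz))
  (path_in_trans mid (sub y py hy)).
have [cpz pzth] := proj_extP cth pz; have [cpy pyth] := proj_extP cth py.
have [cf _ _ _ _] := nf.
have nocross : ~ orient th xi (proj_ext th z) * orient th xi (proj_ext th y) < 0.
  move=> h; have [] := @crossing _ f g cf cg; rewrite ?f0 ?f1 ?g0 ?g1 //.
  - by move=> s; exact: nparam_cdisk nf.
  - by move=> t /gA[].
  move=> s [t [hs ht E]]; have [_] := gA _ ht; apply.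
  by rewrite -E; exact: nparam_mem nf hs.
have nexi : xi <> th by move/esym.
move: hz hy nocross; rewrite /hh => /eqP hz /eqP hy nocross.
apply/idP/idP => h; rewrite ltNge le_eqVlt negb_or eq_sym ?hz ?hy /=; apply/negP => h';
  apply: nocross; rewrite ?(nmulr_rlt0 _ (orient_cw_lt0 cth cxi cpz nexi pzth h'))
    ?(pmulr_rlt0 _ (orient_cw cth cxi cpz nexi pzth h)).
  exact: orient_cw.
exact: orient_cw_lt0.
Qed.

Lemma cw_between th (r : R) : circle th -> 0 < r < 2 * pi ->
  exists xi, [/\ circle xi, xi <> th & cw th xi = r].
Proof.
move=> cth /andP[r0 r2]; have E : cw th (cw_rot r th) = r by rewrite cw_rotK// ltW.
exists (cw_rot r th); split => //; first exact: circle_rot.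
by move=> E'; move: E; rewrite E' cw_self// => E; move: r0; rewrite E ltxx.
Qed.

(** A line from [th] at an intermediate angle separates z from the level [r], and the points near z
    stay on its side. *)
Lemma proj_angle_lt_near th z (r : R) : circle th -> pdisk th z -> hh th z < r ->
  \forall y \near z, pdisk th y -> hh th y < r.
Proof.
move=> cth pz hr; have /andP[h0 h2] := proj_angle_itv cth pz.
(* The angle must exceed that of z and stay below both [r] and 2 pi, as [r] need not be an angle. *)
have [xi [cxi xith xiE]] := @cw_between th (Num.min ((hh th z + r) / 2) ((hh th z + 2 * pi) / 2))
  cth ltac:(rewrite lt_min gt_min; lra).
have [c Cc hc] := line_ex cth cxi (fun E => xith (esym E)).
have zx : hh th z < cw th xi by rewrite xiE lt_min; lra.
have xr : cw th xi < r by rewrite xiE gt_min; lra.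
have zxn : hh th z <> cw th xi by move=> E; move: zx; rewrite E ltxx.
have := proj_angle_side_near Cc hc pz zxn.
by apply: filterS => y h py; have [E _] := h py; apply: lt_trans xr; rewrite E.
Qed.

Lemma proj_angle_gt_near th z (r : R) : circle th -> pdisk th z -> r < hh th z ->
  \forall y \near z, pdisk th y -> r < hh th y.
Proof.
move=> cth pz hr; have /andP[h0 h2] := proj_angle_itv cth pz.
have [xi [cxi xith xiE]] := @cw_between th (Num.max ((hh th z + r) / 2) (hh th z / 2))
  cth ltac:(rewrite lt_max gt_max; lra).
have [c Cc hc] := line_ex cth cxi (fun E => xith (esym E)).
have zx : cw th xi < hh th z by rewrite xiE gt_max; lra.
have xr : r < cw th xi by rewrite xiE lt_max; lra.
have zxn : hh th z <> cw th xi by move=> E; move: zx; rewrite E ltxx.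
have := proj_angle_side_near Cc hc pz zxn.
apply: filterS => y h py; have [E hy] := h py; apply: lt_trans xr _.
by rewrite lt_neqAle leNgt E -leNgt ltW// andbT; apply/eqP => /esym.
Qed.

Lemma proj_angle_continuous th z : circle th -> pdisk th z ->
  hh th y @[y --> within (pdisk th) (nbhs z)] --> hh th z.
Proof.
move=> cth pz; apply/cvgrPdist_lt => e e0.
have h1 : hh th z < hh th z + e by lra.
have h2 : hh th z - e < hh th z by lra.
rewrite near_withinE.
have := proj_angle_lt_near cth pz h1; have := proj_angle_gt_near cth pz h2.
apply: filterS2 => y a b py; rewrite ltr_norml.
by have := a py; have := b py; lra.
Qed.

Lemma proj_angle_continuous_comp (T : topologicalType) th (g : T -> plane) t :
  circle th -> {for t, continuous g} -> (\forall s \near t, pdisk th (g s)) ->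
  {for t, continuous (hh th \o g)}.
Proof.
move=> cth cg pg; have pt : pdisk th (g t) by exact: nbhs_singleton pg.
apply/cvgrPdist_lt => e e0.
have := proj_angle_continuous cth pt => /cvgrPdist_lt/(_ _ e0); rewrite near_withinE => h.
by have := cg _ h; apply: filterS2 pg => s ps hs /=; exact: hs.
Qed.

End Projections.

(** * Monotonicity of the angle along curves, and its dependence on the direction *)

Section Monotonicity.
Context {R : realType}.
Local Notation plane := (R * R)%type.
Implicit Types (x y z p q th xi eta rho : plane) (c : set plane).
Variable C : set (set plane).
Hypothesis hC : curve_family C.
Local Notation hh := (proj_angle C).

Lemma nparam_pdisk g c th t : nparam g c -> circle th -> g 0 <> th -> g 1 <> th ->
  0 <= t <= 1 -> pdisk th (g t).
Proof.
move=> ng cth g0 g1 ht; split; first exact: nparam_cdisk ng ht.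
by move=> E; rewrite -E in cth; have [t0|t1] := nparam_circle ng ht cth;
  [apply: g0|apply: g1]; rewrite -E ?t0 ?t1.
Qed.

Lemma proj_angle_curve_within g c th : nparam g c -> circle th -> g 0 <> th -> g 1 <> th ->
  {within `[0, 1], continuous (hh th \o g)}.
Proof.
move=> ng cth g0 g1; apply/subspace_continuousP => t /=; rewrite in_itv /= => ht.
have pt := nparam_pdisk ng cth g0 g1 ht.
apply/cvgrPdist_lt => e e0.
have := proj_angle_continuous hC cth pt => /cvgrPdist_lt/(_ _ e0); rewrite !near_withinE => h.
have [cg _ _ _ _] := ng.
have h' : \forall s \near t, pdisk th (g s) -> `|hh th (g t) - hh th (g s)| < e := cg t _ h.
apply: filterS h' => s /= hs; rewrite in_itv /= => s01; apply: hs; exact: nparam_pdisk ng cth g0 g1 s01.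
Qed.

(** Two points of c at the same angle also lie on a line d ending at [th]. If both are in the disk,
    (C1) gives c = d; if one is on the circle, it is an end of both curves and (C3) gives c = d.
    Then [th] would be an end of c. Two boundary points at the same angle are equal. *)
Lemma proj_angle_curve_inj g c th : C c -> nparam g c -> circle th -> g 0 <> th -> g 1 <> th ->
  {in `[0, 1] &, injective (hh th \o g)}.
Proof.
move=> Cc ng cth g0 g1 s t; rewrite !in_itv /= => hs ht E.
apply: contrapT => st.
have ps := nparam_pdisk ng cth g0 g1 hs; have pt := nparam_pdisk ng cth g0 g1 ht.
have [cps psth] := proj_extP hC cth ps.
have [d Cd hd] := line_ex hC cth cps (fun e => psth (esym e)).
have ds : d (g s) by apply/(proj_angle_line hC Cd hd ps).
have dt : d (g t) by apply/(proj_angle_line hC Cd hd pt); rewrite -E.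
have cs := nparam_mem ng hs; have ct := nparam_mem ng ht.
have gst : g s <> g t by move=> /(nparam_inj ng hs ht).
have [cth' _ _ dth _] := has_endpoints_circle hd.
suff cd : c = d.
  rewrite -cd in dth; have [u hu thE] := nparam_ex ng dth; rewrite thE in cth.
  by have [uE|uE] := nparam_circle ng hu cth; [apply: g0|apply: g1]; rewrite thE uE.
have [a [b hab]] : exists a b, has_endpoints c a b.
  by exists (g 0), (g 1); apply/has_endpointsP; exists g.
have endd z : d z -> circle z -> z <> th -> exists2 b, has_endpoints d z b & True.
  move=> dz cz zth; have [//|zE] := has_endpoints_mem hd dz cz.
  by exists th => //; rewrite zE; exact: has_endpoints_sym.
have endc z : c z -> circle z -> exists2 b, has_endpoints c z b & True.
  move=> cz cirz; have [->|->] := has_endpoints_mem hab cz cirz; first by exists b.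
  by exists a => //; exact: has_endpoints_sym.
case: (ps) (pt) => /cdiskP[dks|cis] sth [/cdiskP[dkt|cit] tth].
- exact: (curve_uniq hC Cc Cd dks dkt gst).
- have [b1 h1 _] := endc _ ct cit; have [b2 h2 _] := endd _ dt cit tth.
  exact: (ray_uniq hC Cc Cd dks cs ds h1 h2).
- have [b1 h1 _] := endc _ cs cis; have [b2 h2 _] := endd _ ds cis sth.
  exact: (ray_uniq hC Cc Cd dkt ct dt h1 h2).
by exfalso; apply: gst; move: E; rewrite /= !proj_angle_circle// => /cw_inj; apply.
Qed.

Lemma proj_angle_mono g c th : C c -> nparam g c -> circle th -> g 0 <> th -> g 1 <> th ->
  (forall s t, 0 <= s -> s < t -> t <= 1 -> hh th (g s) < hh th (g t)) \/
  (forall s t, 0 <= s -> s < t -> t <= 1 -> hh th (g t) < hh th (g s)).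
Proof.
move=> Cc ng cth g0 g1.
have [h|h] := itv_continuous_inj_mono (proj_angle_curve_within ng cth g0 g1)
  (proj_angle_curve_inj Cc ng cth g0 g1); [left|right] => s t s0 st t1.
  by apply: h; rewrite ?in_itv //=; lra.
by apply: h; rewrite ?in_itv //=; lra.
Qed.

Lemma proj_angle_const g c th : C c -> nparam g c -> g 0 = th \/ g 1 = th ->
  forall s t, 0 < s < 1 -> 0 < t < 1 -> hh th (g s) = hh th (g t).
Proof.
move=> Cc ng gth s t hs ht.
have [xi hc] : exists xi, has_endpoints c th xi.
  have hg : has_endpoints c (g 0) (g 1) by apply/has_endpointsP; exists g.
  by case: gth => <-; [exists (g 1)|exists (g 0); exact: has_endpoints_sym].
have [cth _ _ _ _] := has_endpoints_circle hc.
have [_ _ _ gd _] := ng.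
have E u : 0 < u < 1 -> hh th (g u) = cw th xi.
  move=> hu; apply/(proj_angle_line hC Cc hc); first by apply: disk_pdisk => //; exact: gd.
  by apply: nparam_mem ng _; lra.
by rewrite !E.
Qed.

Lemma proj_angle_between c al be x th : C c -> has_endpoints c al be -> c x -> disk x ->
  circle th -> al <> th -> be <> th ->
  cw th al < hh th x < cw th be \/ cw th be < hh th x < cw th al.
Proof.
move=> Cc hc cx dx cth alth beth.
have [cal cbe _ _ _] := has_endpoints_circle hc.
move: hc => /has_endpointsP[g [ng g0 g1]].
have [t ht xE] := nparam_ex ng cx.
have t01 : 0 < t < 1 by apply: nparam_disk ng ht _; rewrite -xE.
have E0 : cw th al = hh th (g 0) by rewrite g0 proj_angle_circle.
have E1 : cw th be = hh th (g 1) by rewrite g1 proj_angle_circle.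
rewrite E0 E1 xE; rewrite -g0 in alth; rewrite -g1 in beth.
by have [h|h] := proj_angle_mono Cc ng cth alth beth; [left|right]; rewrite !h ?ler01 ?lexx//; lra.
Qed.

(** Take the curve from [rho] through x to its other end. Seen from [th], the angle of x lies
    between those of the two ends, and the cyclic order of [rho], [th] and the other end tells which
    one is larger. Exchanging the two directions moves the dependence on [th] into the boundary
    angle [cw rho th]. *)
Lemma proj_angle_flip th rho x : circle th -> circle rho -> rho <> th -> disk x ->
  (cw rho th < hh rho x -> hh th x < cw th rho) /\
  (hh rho x < cw rho th -> cw th rho < hh th x).
Proof.
move=> cth crho ne dx.
have [c Cc [cx hc]] := projP hC crho dx.
have hE : hh rho x = cw rho (Defs.proj C rho x) by rewrite /proj_angle proj_ext_disk.
have [_ cp np _ _] := has_endpoints_circle hc.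
have symE : cw th rho = 2 * pi - cw rho th by apply: cw_sym => // /esym.
have bet : cw rho th <> hh rho x -> cw th rho < hh th x < cw th (Defs.proj C rho x) \/
    cw th (Defs.proj C rho x) < hh th x < cw th rho.
  move=> nE; apply: (proj_angle_between Cc hc cx dx cth ne) => E.
  by apply: nE; rewrite hE E.
have := cw_change crho cth cp; rewrite -hE => E.
have /andP[h0 h2] := proj_angle_itv hC crho (disk_pdisk crho dx).
split => h.
  have : cw rho th <> hh rho x by move=> E'; move: h; rewrite E' ltxx.
  by move=> /bet[] /andP[]; move: E; rewrite (ltW h) /=; lra.
have : cw rho th <> hh rho x by move=> E'; move: h; rewrite E' ltxx.
by move=> /bet[] /andP[]; move: E; rewrite leNgt h /=; lra.
Qed.

Lemma acw_continuous_r th a : circle th -> circle a -> a <> th ->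
  {for a, continuous (acw th)}.
Proof.
move=> cth ca ath.
have d0 : 1 - dot th a != 0 by rewrite gt_eqF// tangent_gt0//; exact: circle_cdisk.
have := acw_continuous d0; rewrite /prop_for => h.
apply: (@cvg_comp _ _ _ (fun b => (th, b)) (fun v => acw v.1 v.2) _ (nbhs (th, a))) => //.
exact: (cvg_pair (cvg_cst th) cvg_id).
Qed.

Lemma acw_continuous_l th a : circle th -> circle a -> a <> th ->
  {for th, continuous (acw^~ a)}.
Proof.
move=> cth ca ath.
have d0 : 1 - dot th a != 0 by rewrite gt_eqF// tangent_gt0//; exact: circle_cdisk.
have := acw_continuous d0; rewrite /prop_for => h.
apply: (@cvg_comp _ _ _ (fun b => (b, a)) (fun v => acw v.1 v.2) _ (nbhs (th, a))) => //.
exact: (cvg_pair cvg_id (cvg_cst a)).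
Qed.

Lemma neq_near (x y : plane) : x <> y -> \forall z \near x, z <> y.
Proof.
move=> xy; have : open (~` [set y]).
  by apply: closed_openC; apply: accessible_closed_set1; apply: hausdorff_accessible; exact: norm_hausdorff.
by rewrite openE => /(_ x xy).
Qed.

(** For [rho] at an angle between that of x and [r], the flip yields [cw rho th < hh rho x]. Here
    only the boundary angle varies with [th], continuously; flipping back at a nearby t gives
    [hh t x < cw t rho < r]. *)
Lemma proj_angle_dir_lt_near th x (r : R) : circle th -> disk x -> hh th x < r ->
  \forall t \near th, circle t -> hh t x < r.
Proof.
move=> cth dx hr; have /andP[h0 h2] := proj_angle_itv hC cth (disk_pdisk cth dx).
have [rho [crho ne rhoE]] := @cw_between _ th
  (Num.min ((hh th x + r) / 2) ((hh th x + 2 * pi) / 2)) cth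
  ltac:(rewrite lt_min gt_min; lra).
have xr : hh th x < cw th rho by rewrite rhoE lt_min; lra.
have rr : cw th rho < r by rewrite rhoE gt_min; lra.
have ne' : th <> rho by move/esym.
have hx : cw rho th < hh rho x by have [_] := proj_angle_flip crho cth ne' dx; apply.
have n1 : \forall t \near th, acw rho t < hh rho x.
  have := @acw_continuous_r rho th crho cth ne' => /cvgr_lt; apply.
  by rewrite -cwE.
have n2 : \forall t \near th, acw t rho < r.
  have := @acw_continuous_l th rho cth crho ne => /cvgr_lt; apply.
  by rewrite -cwE.
near=> t => ct.
have tn : t <> rho by near: t; exact: neq_near.
have tn' : rho <> t by move/esym.
have [h _] := proj_angle_flip ct crho tn' dx.
apply: (@lt_trans _ _ (cw t rho)); last by rewrite cwE//; near: t.
by apply: h; rewrite cwE//; near: t.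
Unshelve. all: by end_near. Qed.

Lemma proj_angle_dir_gt_near th x (r : R) : circle th -> disk x -> r < hh th x ->
  \forall t \near th, circle t -> r < hh t x.
Proof.
move=> cth dx hr; have /andP[h0 h2] := proj_angle_itv hC cth (disk_pdisk cth dx).
have [rho [crho ne rhoE]] := @cw_between _ th
  (Num.max ((hh th x + r) / 2) (hh th x / 2)) cth
  ltac:(rewrite lt_max gt_max; lra).
have xr : cw th rho < hh th x by rewrite rhoE gt_max; lra.
have rr : r < cw th rho by rewrite rhoE lt_max; lra.
have ne' : th <> rho by move/esym.
have hx : hh rho x < cw rho th by have [+ _] := proj_angle_flip crho cth ne' dx; apply.
have n1 : \forall t \near th, hh rho x < acw rho t.
  have := @acw_continuous_r rho th crho cth ne' => /cvgr_gt; apply.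
  by rewrite -cwE.
have n2 : \forall t \near th, r < acw t rho.
  have := @acw_continuous_l th rho cth crho ne => /cvgr_gt; apply.
  by rewrite -cwE.
near=> t => ct.
have tn : t <> rho by near: t; exact: neq_near.
have tn' : rho <> t by move/esym.
have [_ h] := proj_angle_flip ct crho tn' dx.
apply: (@lt_trans _ _ (cw t rho)); first by rewrite cwE//; near: t.
by apply: h; rewrite cwE//; near: t.
Unshelve. all: by end_near. Qed.

(** Move slightly in both directions along a curve through x that does not end at [th]; the angle is
    strictly monotone on it. *)
Lemma open_no_extremum (P : set plane) th x : open P -> P `<=` disk -> P x -> circle th ->
  exists y z, [/\ P y, P z & hh th y < hh th x < hh th z].
Proof.
move=> oP Pd Px cth; have dx := Pd _ Px.
have /andP[h0 h2] := proj_angle_itv hC cth (disk_pdisk cth dx).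
(* Half the angle of x: if the curve from [rho] through x ended at [th], x would have the angle of
   [rho]. *)
have [rho [crho ne rhoE]] := @cw_between _ th (hh th x / 2) cth ltac:(lra).
have [c Cc [cx hc]] := projP hC crho dx.
have np : Defs.proj C rho x <> th.
  move=> E; rewrite E in hc.
  have /(proj_angle_line hC Cc (has_endpoints_sym hc) (disk_pdisk cth dx)) := cx.
  by rewrite rhoE; lra.
move: (hc) => /has_endpointsP[g [ng g0 g1]].
have [t ht xE] := nparam_ex ng cx; have [cg _ _ _ _] := ng.
have t01 : 0 < t < 1 by apply: nparam_disk ng ht _; rewrite -xE.
have : nbhs t (g @^-1` P) by apply: cg; rewrite -xE; apply: open_nbhs_nbhs.
move=> /nbhs_ballP[e /= e0 be].
pose d := Num.min (e / 2) (Num.min (t / 2) ((1 - t) / 2)).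
have d0 : 0 < d by rewrite !lt_min; lra.
have de : d <= e / 2 by rewrite ge_min lexx.
have dt : d <= t / 2 by rewrite !ge_min lexx !orbT.
have d1 : d <= (1 - t) / 2 by rewrite !ge_min lexx !orbT.
have Pm : P (g (t - d)) by apply: be; rewrite /ball /= opprB addrC subrK gtr0_norm//; lra.
have Pp : P (g (t + d)) by apply: be; rewrite /ball /= opprD addrA subrr sub0r normrN gtr0_norm//; lra.
rewrite -g0 in ne; rewrite -g1 in np; have [h|h] := proj_angle_mono Cc ng cth ne np.
  by exists (g (t - d)), (g (t + d)); rewrite xE !h//; lra.
by exists (g (t + d)), (g (t - d)); rewrite xE !h//; lra.
Qed.

End Monotonicity.

(** * Regions bounded by two lines and an arc, as sectors of the angle *)

Section Regions.
Context {R : realType}.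
Local Notation plane := (R * R)%type.

(** Asks only for local positive lower bounds, not for continuity of [f]; it will be applied to the
    gap between the angle of a point and an extremal angle, as a function of the direction. *)
Lemma compact_lower_bound (T : topologicalType) (K : set T) (f : T -> R) : compact K ->
  (forall z : T, K z -> exists2 r, 0 < r & \forall y \near z, K y -> r < f y) ->
  exists2 e, 0 < e & forall z : T, K z -> e < f z.
Proof.
move=> /compact_near_coveringP cK hf.
have [|n0 _ /(_ n0 (leqnn _)) /= hn] :=
    cK nat \oo (fun n y => K y -> n.+1%:R^-1 < f y) _.
  move=> z Kz; have [r r0 hr] := hf z Kz.
  exists ([set y | K y -> r < f y], [set n | n.+1%:R^-1 < r]).
    by split => //; exact: (near_infty_natSinv_lt (PosNum r0)).
  by move=> [y n] /= [h1 h2] Ky; exact: lt_trans (h1 Ky).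
by exists n0.+1%:R^-1; rewrite ?invr_gt0 ?ltr0n// => z Kz; exact: hn.
Qed.

Implicit Types (x y z p q th xi eta rho : plane) (c : set plane).

Lemma path_in_component (A : set plane) x y : path_in A x y -> connected_component A x y.
Proof.
move=> [p [cp p0 p1 pA]].
have m0 : `[0, 1]%classic (0 : R) by rewrite /= in_itv /= lexx ler01.
have m1 : `[0, 1]%classic (1 : R) by rewrite /= in_itv /= lexx ler01.
apply: (@connected_component_max _ A (p @` `[0, 1])).
- by exists 0.
- by move=> _ [t ht <-]; apply: pA; move: ht; rewrite /= in_itv.
- apply: connected_continuous_connected; first exact: segment_connected.
  exact: continuous_subspaceT.
by exists 1.
Qed.

Lemma path_in_ray (J : set plane) z (r : R) : J `<=` cdisk -> ~ J z -> ~ disk z ->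
  1 <= r -> path_in (~` J) z (r * z.1, r * z.2).
Proof.
move=> Jd Jz dz r1; apply: path_in_lerp => t /andP[t0 t1].
have -> : lerp z (r * z.1, r * z.2) t = ((1 + t * (r - 1)) * z.1, (1 + t * (r - 1)) * z.2).
  by rewrite /lerp /=; congr pair; ring.
have : 0 <= t * (r - 1) by rewrite mulr_ge0// subr_ge0.
move: (t * (r - 1)) => u; rewrite le_eqVlt => /orP[/eqP <-|u0].
  by rewrite addr0 !mul1r -surjective_pairing.
move=> /Jd; rewrite /cdisk /= !exprMn -mulrDr.
have : 1 <= z.1 ^+ 2 + z.2 ^+ 2 by rewrite leNgt; apply/negP.
by move: (z.1 ^+ 2 + z.2 ^+ 2) => v v1; nra.
Qed.

Lemma unbounded_rays (K : set plane) z : ~ disk z ->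
  (forall r, 1 <= r -> K (r * z.1, r * z.2)) -> ~ bounded_set K.
Proof.
move=> dz hK bK.
have [M [M0 hM]] : exists M : R, 0 < M /\ forall x, K x -> `|x| <= M.
  have g0 : \forall M \near +oo, (0 : R) < M by exact: nbhs_pinfty_gt.
  have h : \forall M \near +oo, 0 < M /\ forall x, K x -> `|x| <= M.
    by apply: filterS2 g0 bK => M M0 hM; split.
  by have [M hM] := filter_ex h; exists M.
(* The norm is the maximum norm, so a bound M gives only 2 M^2 for the Euclidean square; (2 M + 1)^2
   exceeds it. *)
have r1 : 1 <= 2 * M + 1 by lra.
have := hM _ (hK _ r1); rewrite prod_normE ge_max /= !ler_norml => /andP[h1 h2].
have : 1 <= z.1 ^+ 2 + z.2 ^+ 2 by rewrite leNgt; apply/negP.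
move: h1 h2; set r := 2 * M + 1 => /andP[a1 a2] /andP[b1 b2] h.
have sqle (u v : R) : - v <= u -> u <= v -> u ^+ 2 <= v ^+ 2 by clear; nra.
have h1 := sqle _ _ a1 a2; have h2 := sqle _ _ b1 b2.
have : r ^+ 2 * 1 <= M ^+ 2 + M ^+ 2.
  apply: le_trans (_ : r ^+ 2 * (z.1 ^+ 2 + z.2 ^+ 2) <= _).
    by rewrite ler_wpM2l// sqr_ge0.
  by rewrite mulrDr -!exprMn lerD.
by rewrite /r; nra.
Qed.

Variable C : set (set plane).
Hypothesis hC : curve_family C.
Local Notation hh := (proj_angle C).

Definition sector th xi eta : set plane :=
  [set z | disk z /\
     Num.min (cw th xi) (cw th eta) < hh th z < Num.max (cw th xi) (cw th eta)].

Lemma disk_open : open (@disk R).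
Proof.
have cn : continuous (fun z : plane => z.1 ^+ 2 + z.2 ^+ 2).
  move=> z; apply: cvgD; apply: cvgM; by [exact: continuous_fst|exact: continuous_snd].
have -> : disk = (fun z : plane => z.1 ^+ 2 + z.2 ^+ 2) @^-1` [set t | t < 1] by [].
by apply: open_comp; [move=> z _; exact: cn|exact: open_lt].
Qed.

Lemma cdisk_closed : closed (@cdisk R).
Proof.
have cn : continuous (fun z : plane => z.1 ^+ 2 + z.2 ^+ 2).
  move=> z; apply: cvgD; apply: cvgM; by [exact: continuous_fst|exact: continuous_snd].
have -> : cdisk = (fun z : plane => z.1 ^+ 2 + z.2 ^+ 2) @^-1` [set t | t <= 1] by [].
by apply: closed_comp; [move=> z _; exact: cn|exact: closed_le].
Qed.

Lemma sector_open th xi eta : circle th -> open (sector th xi eta).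
Proof.
move=> cth; rewrite openE => z [dz /andP[h1 h2]]; rewrite /interior.
have pz := disk_pdisk cth dz.
have nd : \forall y \near z, disk y by apply: open_nbhs_nbhs; split => //; exact: disk_open.
near=> y; have dy : disk y by near: y.
split => //; have py := disk_pdisk cth dy.
apply/andP; split; move: py; near: y; [exact: proj_angle_gt_near|exact: proj_angle_lt_near].
Unshelve. all: by end_near. Qed.

(** A point outside the sector and off J escapes to infinity: along its line to its projection, at
    an angle which J avoids, then radially. Conversely the sector is open, and its closure adds only
    points of J; it is therefore open and closed in the complement of J, and a connected set
    starting in it stays in it. *)
Lemma region_sector th xi eta : circle th -> circle xi -> circle eta ->
  xi <> th -> eta <> th -> region C th xi eta = sector th xi eta.
Proof.
move=> cth cxi ceta nxi neta.
have [C1 h1] := clineP hC cth cxi (fun e => nxi (esym e)).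
have [C2 h2] := clineP hC cth ceta (fun e => neta (esym e)).
rewrite /region; set L1 := cline C th xi in C1 h1 *; set L2 := cline C th eta in C2 h2 *.
set J := _ `|` _ `|` _.
have Jd : J `<=` cdisk.
  move=> z [[]|[cz _]]; last exact: circle_cdisk.
    by move: h1 => /has_endpointsP[g [ng _ _]] /(nparam_ex ng)[t ht ->]; exact: nparam_cdisk ng ht.
  by move: h2 => /has_endpointsP[g [ng _ _]] /(nparam_ex ng)[t ht ->]; exact: nparam_cdisk ng ht.
have Jth : J th by left; left; have [_ _ _ ? _] := has_endpoints_circle h1.
set m := Num.min (cw th xi) (cw th eta); set M := Num.max (cw th xi) (cw th eta).
have hmM w : w = m \/ w = M -> w = cw th xi \/ w = cw th eta.
  by rewrite /m /M; case: (leP (cw th xi) (cw th eta)) => _ []; tauto.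
have JP z : pdisk th z -> ~ J z -> hh th z <> m /\ hh th z <> M.
  move=> pz Jz; have no w : w = cw th xi \/ w = cw th eta -> hh th z <> w.
    move=> [->|->] E; apply: Jz; left; [left|right].
      by apply/(proj_angle_line hC C1 h1 pz).
    by apply/(proj_angle_line hC C2 h2 pz).
  by split; apply/no/hmM; [left|right].
have mM : m <= M by rewrite /m /M le_max ge_min lexx.
have xiin : m <= cw th xi <= M by rewrite /m /M ge_min le_max lexx.
have etain : m <= cw th eta <= M by rewrite /m /M ge_min le_max lexx !orbT.
have JU z : pdisk th z -> J z -> m <= hh th z <= M.
  move=> pz [[/(proj_angle_line hC C1 h1 pz) ->//|/(proj_angle_line hC C2 h2 pz) ->//]|[cz hz]].
  by rewrite proj_angle_circle.
apply/seteqP; split => z.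
- move=> [Jz bz]; apply: contrapT => Uz.
  have rays p : path_in (~` J) z p -> ~ disk p -> ~ J p -> False.
    move=> zp dp Jp; apply: (unbounded_rays dp _ bz) => r r1.
    by apply: path_in_component; exact: path_in_trans zp (path_in_ray Jd Jp dp r1).
  have [dz|ndz] := pselect (disk z); last first.
    by apply: (rays z) => //; exists (fun=> z); split => // t; exact: cvg_cst.
  have pz := disk_pdisk cth dz; have [hzm hzM] := JP z pz Jz.
  have out : ~ m <= hh th z <= M.
    move=> /andP[a b]; apply: Uz; split => //; rewrite -/m -/M !lt_neqAle a b !andbT.
    by apply/andP; split; apply/eqP => // /esym.
  have [cp np] := proj_extP hC cth pz.
  have sub : pdisk th `&` [set w | hh th w = hh th z] `<=` ~` J.
    by move=> w [pw /= hw] /(JU w pw); rewrite hw.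
  apply: (rays (proj_ext C th z)).
  + by apply: path_in_sub sub _; exact: path_to_proj.
  + by move=> /disk_circle.
  apply: sub; split; first by split => //; exact: circle_cdisk.
  by rewrite /= proj_angle_circle.
- move=> Uz; have [dz /andP[h3 h4]] := Uz.
  have Jz : ~ J z.
    move=> [[]|[/(disk_circle dz)//]].
      move/(proj_angle_line hC C1 h1 (disk_pdisk cth dz)) => E.
      by move: h3 h4; rewrite E -/m -/M; move: xiin; rewrite /m /M;
        case: (leP (cw th xi) (cw th eta)) => _; rewrite ?ltxx.
    move/(proj_angle_line hC C2 h2 (disk_pdisk cth dz)) => E.
    by move: h3 h4; rewrite E -/m -/M; move: xiin; rewrite /m /M;
      case: (leP (cw th xi) (cw th eta)) => _; rewrite ?ltxx.
  split => //.
  have KU : connected_component (~` J) z `<=` sector th xi eta.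
    move=> y [B [Bz BJ cB] By].
    suff E : B `&` sector th xi eta = B by move: By; rewrite -E => -[].
    apply: cB; first by exists z.
      by exists (sector th xi eta) => //; exact: sector_open.
    exists (closure (sector th xi eta)); first exact: closed_closure.
    apply/seteqP; split => w [Bw]; first by move=> Uw; split => //; exact: subset_closure.
    move=> clw; split => //.
    have cw' : cdisk w.
      apply: cdisk_closed; apply: closure_subset clw => v [dv _]; exact: disk_cdisk.
    have pw : pdisk th w by split => // E; apply: (BJ w Bw); rewrite E.
    have [nm nM] := JP w pw (BJ w Bw).
    have nb : m <= hh th w <= M.
      apply/andP; split; rewrite leNgt; apply/negP => h.
        have [v [[dv /andP[a b]] /(_ (disk_pdisk cth dv)) c]] := clw _ (proj_angle_lt_near hC cth pw h).
        by move: a; rewrite -/m ltNge (ltW c).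
      have [v [[dv /andP[a b]] /(_ (disk_pdisk cth dv)) c]] := clw _ (proj_angle_gt_near hC cth pw h).
      by move: b; rewrite -/M ltNge (ltW c).
    have [dw|ciw] := cdiskP cw'; last first.
      by exfalso; apply: (BJ w Bw); right; split => //; rewrite -(proj_angle_circle C th ciw).
    split => //; case/andP: nb => a b; rewrite -/m -/M !lt_neqAle a b !andbT.
    by apply/andP; split; apply/eqP => // /esym.
  rewrite /bounded_set /bounded_near; near=> M0 => w /KU[dw _] /=.
  rewrite prod_normE; apply: (@le_trans _ _ 1); last by near: M0; exact: nbhs_pinfty_ge.
  have sq (a b : R) : a ^+ 2 + b ^+ 2 < 1 -> `|a| <= 1.
    move=> h; rewrite -(@ler_pXn2r _ 2)// ?nnegrE// real_normK ?num_real// expr1n.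
    by have := sqr_ge0 b; lra.
  by rewrite ge_max (sq _ w.2)// (sq _ w.1)// addrC.
Unshelve. all: by end_near. Qed.

End Regions.

(** * Extremal angles of the polygon and the pseudo-metrics *)

Section Polygon.
Context {R : realType}.
Local Notation plane := (R * R)%type.
Implicit Types (x y z p q th xi eta rho : plane) (c : set plane).
Variable C : set (set plane).
Hypothesis hC : curve_family C.
Local Notation hh := (proj_angle C).
Variables (P : set plane) (sides : seq (plane * plane)).
Hypothesis hP : convex_polygon C P sides.

Lemma seg_disk x y z : disk x -> disk y -> seg C x y z -> disk z.
Proof.
move=> dx dy [c [g [a [b [s [t [u [Cc ng [hs ht hu] [gs gt gu]]]]]]]]].
have [ab _ _ [ga gb] [gd _]] := ng.
have int v : v \in `[a, b] -> disk (g v) -> a < v < b.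
  rewrite in_itv /= => /andP[av vb] dv; rewrite !lt_neqAle av vb !andbT.
  by apply/andP; split; apply/eqP => E; move: dv ga gb; [rewrite -E|rewrite E] => /disk_circle.
rewrite -gs in dx; rewrite -gt in dy.
have /andP[s1 s2] := int _ hs dx; have /andP[t1 t2] := int _ ht dy.
rewrite -gu; apply: gd; move: hu; rewrite !in_itv /= => /andP[u1 u2].
apply/andP; split; first by apply: lt_le_trans u1; rewrite lt_min s1.
by apply: le_lt_trans u2 _; rewrite gt_max s2.
Qed.

Lemma polygon_disk : P `<=` disk. Proof. by case: hP. Qed.

Lemma polygon_open : open P. Proof. by case: hP. Qed.

Lemma closure_polygon z : closure P z -> P z \/
  exists2 e, e \in sides & seg C e.1 e.2 z.
Proof.
have [_ _ oP _ [_ bE]] := hP => cz.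
have [?|Pz] := pselect (P z); [by left|right].
suff : boundary P z by rewrite bE.
by split => //; rewrite (interior_id _).1.
Qed.

(** Sides have their ends in the open disk and thus stay in it. So the compact set [closure P] is
    disjoint from the circle, and the angle is continuous on it for every [th]. *)
Lemma closure_polygon_disk : closure P `<=` disk.
Proof.
have [_ Pd _ _ [sd _]] := hP => z /closure_polygon[/Pd//|[e /sd[d1 d2 _]]].
exact: seg_disk.
Qed.

Lemma closure_polygon_compact : compact (closure P).
Proof.
apply: (@subclosed_compact _ _ (`[-1, 1]%classic `*` `[-1, 1]%classic : set plane)).
- exact: closed_closure.
- by apply: compact_setX; exact: segment_compact.
move=> z /closure_polygon_disk; rewrite /disk /= => dz.
have := sqr_ge0 z.1; have := sqr_ge0 z.2 => h2 h1.
by split; rewrite /= in_itv /=; apply/andP; split; nra.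
Qed.

Lemma compact_circle : compact (@circle R).
Proof.
apply: (@subclosed_compact _ _ (`[-1, 1]%classic `*` `[-1, 1]%classic : set plane)).
- have cn : continuous (fun z : plane => z.1 ^+ 2 + z.2 ^+ 2).
    move=> z; apply: cvgD; apply: cvgM; by [exact: continuous_fst|exact: continuous_snd].
  have -> : circle = (fun z : plane => z.1 ^+ 2 + z.2 ^+ 2) @^-1` [set t | t = 1] by [].
  by apply: closed_comp; [move=> z _; exact: cn|exact: closed_eq].
- by apply: compact_setX; exact: segment_compact.
move=> z; rewrite /circle /= => dz.
have := sqr_ge0 z.1; have := sqr_ge0 z.2 => h2 h1.
by split; rewrite /= in_itv /=; apply/andP; split; nra.
Qed.

Definition inf_angle th : R := inf (hh th @` P).
Definition sup_angle th : R := sup (hh th @` P).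

Lemma proj_angle_closure_bounds th : circle th ->
  exists2 e, 0 < e & forall z, closure P z -> e < hh th z /\ hh th z < 2 * pi - e.
Proof.
move=> cth.
have pd z : closure P z -> pdisk th z by move=> /closure_polygon_disk; exact: disk_pdisk.
have [z cz|e1 e10 h1] := @compact_lower_bound _ _ _ (hh th) closure_polygon_compact.
  have /andP[h0 _] := proj_angle_itv hC cth (pd z cz); exists (hh th z / 2); first by lra.
  have h : hh th z / 2 < hh th z by lra.
  by apply: filterS (proj_angle_gt_near hC cth (pd z cz) h) => y hy /pd.
have [z cz|e2 e20 h2] := @compact_lower_bound _ _ _ (fun z => 2 * pi - hh th z) closure_polygon_compact.
  have /andP[_ h0] := proj_angle_itv hC cth (pd z cz); exists ((2 * pi - hh th z) / 2); first by lra.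
  have h : hh th z < 2 * pi - (2 * pi - hh th z) / 2 by lra.
  by apply: filterS (proj_angle_lt_near hC cth (pd z cz) h) => y hy /pd /hy; lra.
exists (Num.min e1 e2); first by rewrite lt_min e10.
move=> z cz; have := h1 z cz; have := h2 z cz.
have m1 : Num.min e1 e2 <= e1 by rewrite ge_min lexx.
have m2 : Num.min e1 e2 <= e2 by rewrite ge_min lexx orbT.
by move=> ? ?; split; lra.
Qed.

Lemma proj_angle_image_bounded th : circle th -> has_inf (hh th @` P) /\ has_sup (hh th @` P).
Proof.
move=> cth; have [e e0 he] := proj_angle_closure_bounds cth.
have [[z0 Pz0] _ _ _ _] := hP.
have ne : (hh th @` P) !=set0 by exists (hh th z0), z0.
split; split => //.
  by exists 0 => _ [z Pz <-]; have [] := he z (subset_closure Pz); lra.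
by exists (2 * pi) => _ [z Pz <-]; have [] := he z (subset_closure Pz); lra.
Qed.

Lemma angle_bounds_closure th z : circle th -> closure P z ->
  inf_angle th <= hh th z <= sup_angle th.
Proof.
move=> cth cz; have [hinf hsup] := proj_angle_image_bounded cth.
have pz := disk_pdisk cth (closure_polygon_disk cz).
apply/andP; split; rewrite leNgt; apply/negP => h.
  have [y [Py /= hy]] := cz _ (proj_angle_lt_near hC cth pz h).
  have := hy (disk_pdisk cth (polygon_disk Py)); rewrite ltNge => /negP; apply.
  by apply: ge_inf; [case: hinf|exists y].
have [y [Py /= hy]] := cz _ (proj_angle_gt_near hC cth pz h).
have := hy (disk_pdisk cth (polygon_disk Py)); rewrite ltNge => /negP; apply.
by apply: ub_le_sup; [case: hsup|exists y].
Qed.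

Lemma angle_bounds th z : circle th -> P z -> inf_angle th < hh th z < sup_angle th.
Proof.
move=> cth Pz.
have [y [w [Py Pw /andP[h1 h2]]]] := open_no_extremum hC polygon_open polygon_disk Pz cth.
have /andP[a _] := angle_bounds_closure cth (subset_closure Py).
have /andP[_ b] := angle_bounds_closure cth (subset_closure Pw).
by rewrite (le_lt_trans a h1) (lt_le_trans h2 b).
Qed.

Lemma inf_sup_angle_itv th : circle th ->
  [/\ 0 < inf_angle th, inf_angle th < sup_angle th & sup_angle th < 2 * pi].
Proof.
move=> cth; have [e e0 he] := proj_angle_closure_bounds cth; have [[z0 Pz0] _ _ _ _] := hP.
have [hinf hsup] := proj_angle_image_bounded cth.
split.
- apply: lt_le_trans e0 _; apply: lb_le_inf; first by case: hinf.
  by move=> _ [z Pz <-]; apply: ltW; have [] := he z (subset_closure Pz).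
- by have /andP[] := angle_bounds cth Pz0; exact: lt_trans.
apply: (@le_lt_trans _ _ (2 * pi - e)); last by lra.
apply: ge_sup; first by case: hsup.
by move=> _ [z Pz <-]; apply: ltW; have [] := he z (subset_closure Pz).
Qed.

Lemma sub_sector th xi eta : circle th ->
  P `<=` sector C th xi eta ->
  Num.min (cw th xi) (cw th eta) <= inf_angle th /\ sup_angle th <= Num.max (cw th xi) (cw th eta).
Proof.
move=> cth sub; have [hinf hsup] := proj_angle_image_bounded cth; split.
  apply: lb_le_inf; first by case: hinf.
  by move=> _ [z /sub[_ /andP[/ltW h _]] <-].
apply: ge_sup; first by case: hsup.
by move=> _ [z /sub[_ /andP[_ /ltW h]] <-].
Qed.

Lemma sector_hit th (r : R) : circle th -> 0 < r < 2 * pi -> exists2 z, disk z & hh th z = r.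
Proof.
move=> cth hr; have [xi [cxi ne xiE]] := cw_between cth hr.
have [c Cc hc] := line_ex hC cth cxi (fun e => ne (esym e)).
move: (hc) => /has_endpointsP[g [ng g0 g1]].
have d2 : disk (g (1 / 2)) by have [_ _ _ gd _] := ng; apply: gd; lra.
exists (g (1 / 2)) => //; rewrite -xiE; apply/(proj_angle_line hC Cc hc (disk_pdisk cth d2)).
by apply: nparam_mem ng _; lra.
Qed.

(** The sector between the extremal angles is supporting, so the choice by [get] is a genuine one.
    The chosen sector contains P, hence this sector, and equals it by minimality; since every angle
    in ]0, 2 pi[ is attained in the disk, equal sectors have equal bounds. *)
Lemma g_cw th : circle th -> cw th (g1 C P th) = sup_angle th /\ cw th (g2 C P th) = inf_angle th.
Proof.
move=> cth; have [l0 lh h2] := inf_sup_angle_itv cth.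
have [xi [cxi nxi xiE]] := @cw_between _ th (sup_angle th) cth ltac:(lra).
have [eta [ceta neta etaE]] := @cw_between _ th (inf_angle th) cth ltac:(lra).
have secE z : sector C th xi eta z <-> disk z /\ inf_angle th < hh th z < sup_angle th.
  by rewrite /sector /= xiE etaE (min_idPr (ltW lh)) (max_idPl (ltW lh)).
have Psec : P `<=` sector C th xi eta.
  by move=> z Pz; apply/secE; split; [exact: polygon_disk|exact: angle_bounds].
have sup0 : supporting C P th xi eta.
  split; first by split => //; rewrite xiE etaE l0.
    by rewrite region_sector.
  move=> xi' eta' cxi' ceta' nxi' neta'; rewrite !region_sector// => /(sub_sector cth)[a b] sub.
  apply/seteqP; split => // z /secE[dz /andP[h1 h3]]; split => //.
  by rewrite (le_lt_trans a h1) (lt_le_trans h3 b).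
have : supporting C P th (g1 C P th) (g2 C P th).
  apply: (@getPex _ [set p : plane * plane | supporting C P th p.1 p.2]).
  by exists (xi, eta).
move: (g1 C P th) (g2 C P th) => xi' eta' [[cxi' ceta' /andP[e0 ex]] Psub mini].
have neta' : eta' <> th by move=> E; move: e0; rewrite E cw_self// ltxx.
have nxi' : xi' <> th by move=> E; move: (lt_trans e0 ex); rewrite E cw_self// ltxx.
rewrite region_sector// in Psub mini.
have [a b] := sub_sector cth Psub.
have mE : Num.min (cw th xi') (cw th eta') = cw th eta' by rewrite (min_idPr (ltW ex)).
have ME : Num.max (cw th xi') (cw th eta') = cw th xi' by rewrite (max_idPl (ltW ex)).
rewrite mE in a; rewrite ME in b.
have /andP[_ x2] := cw_itv cth cxi'.
have E : sector C th xi eta = sector C th xi' eta'.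
  rewrite -(mini xi eta)// ?region_sector// => z /secE[dz /andP[h1 h3]]; split => //.
  by rewrite mE ME (le_lt_trans a h1) (lt_le_trans h3 b).
have key r : cw th eta' < r < cw th xi' -> inf_angle th < r < sup_angle th.
  move=> /andP[r1 r2]; have [z dz zE] := @sector_hit th r cth ltac:(lra).
  have : sector C th xi' eta' z by split => //; rewrite mE ME zE r1.
  by rewrite -E => /secE[_]; rewrite zE.
split; apply/eqP; rewrite eq_le ?a ?b ?andbT /= leNgt; apply/negP => h.
  have := key (sup_angle th) ltac:(lra); lra.
have := key (inf_angle th) ltac:(lra); lra.
Qed.

(** The logit of the angle relative to the interval ]inf, sup[: increasing, onto the real line,
    infinite at both ends. *)
Definition log_coord th z : R := ln ((hh th z - inf_angle th) / (sup_angle th - hh th z)).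

Lemma log_coord_mono th x y : circle th -> P x -> P y ->
  (log_coord th x <= log_coord th y) = (hh th x <= hh th y).
Proof.
move=> cth Px Py; have /andP[x1 x2] := angle_bounds cth Px; have /andP[y1 y2] := angle_bounds cth Py.
rewrite /log_coord ler_ln ?posrE; try by apply: divr_gt0; lra.
rewrite ler_pdivrMr; last by lra.
rewrite mulrAC ler_pdivlMr; last by lra.
have -> : ((hh th x - inf_angle th) * (sup_angle th - hh th y) <=
    (hh th y - inf_angle th) * (sup_angle th - hh th x)) =
  (0 <= (sup_angle th - inf_angle th) * (hh th y - hh th x)) by apply/idP/idP => h; lra.
by rewrite pmulr_rge0; lra.
Qed.

(** The logarithm of the cross-ratio is a difference of two logits. The case distinction in [dtheta]
    picks the order in which it is non-negative, hence the absolute value. *)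
Lemma dthetaE th x y : circle th -> P x -> P y ->
  dtheta C P th x y = `|log_coord th x - log_coord th y|.
Proof.
move=> cth Px Py; rewrite /dtheta.
have hhE z : P z -> cw th (Defs.proj C th z) = hh th z.
  by move=> /polygon_disk dz; rewrite /proj_angle proj_ext_disk.
rewrite !hhE//; have [g1E g2E] := g_cw cth.
have lrE z w : P z -> P w ->
    log_ratio th (g1 C P th) (g2 C P th) (Defs.proj C th z) (Defs.proj C th w) =
    log_coord th z - log_coord th w.
  move=> Pz Pw; have /andP[z1 z2] := angle_bounds cth Pz; have /andP[w1 w2] := angle_bounds cth Pw.
  rewrite /log_ratio /arc_length !hhE// g1E g2E.
  rewrite ![`|inf_angle th - _|]distrC !gtr0_norm; try by lra.
  rewrite /log_coord -ln_div ?posrE; try by apply: divr_gt0; lra.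
  congr ln; field; rewrite !gt_eqF//; lra.
case: ifPn => h; rewrite lrE//.
  by rewrite ger0_norm// subr_ge0 log_coord_mono.
by rewrite distrC ger0_norm// subr_ge0 log_coord_mono// ltW// ltNge.
Qed.

(** Near a given direction, x is compared with one fixed point y of P of smaller (or larger) angle.
    The angles of x and y vary continuously with the direction, so their difference bounds the gap
    locally; the circle is compact. *)
Lemma uniform_gap x : P x -> exists2 e, 0 < e &
  forall th, circle th -> e < hh th x - inf_angle th /\ e < sup_angle th - hh th x.
Proof.
move=> Px; have dx := polygon_disk Px.
have [th cth|e1 e10 h1] := @compact_lower_bound _ _ _ (fun th => hh th x - inf_angle th) compact_circle.
  have [y [_ [Py _ /andP[hy _]]]] := open_no_extremum hC polygon_open polygon_disk Px cth.
  (* The angles of x and y may each move by a third of their difference; a third of it remains. *)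
  pose r := (hh th x - hh th y) / 3.
  have r0 : 0 < r by rewrite /r; lra.
  have n1 := @proj_angle_dir_gt_near _ _ hC th x (hh th x - r) cth dx ltac:(lra).
  have n2 := @proj_angle_dir_lt_near _ _ hC th y (hh th y + r) cth (polygon_disk Py) ltac:(lra).
  exists r => //; apply: filterS2 n1 n2 => t a b ct.
  have := a ct; have := b ct; have /andP[+ _] := angle_bounds ct Py; rewrite /r; lra.
have [th cth|e2 e20 h2] := @compact_lower_bound _ _ _ (fun th => sup_angle th - hh th x) compact_circle.
  have [_ [y [_ Py /andP[_ hy]]]] := open_no_extremum hC polygon_open polygon_disk Px cth.
  pose r := (hh th y - hh th x) / 3.
  have r0 : 0 < r by rewrite /r; lra.
  have n1 := @proj_angle_dir_lt_near _ _ hC th x (hh th x + r) cth dx ltac:(lra).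
  have n2 := @proj_angle_dir_gt_near _ _ hC th y (hh th y - r) cth (polygon_disk Py) ltac:(lra).
  exists r => //; apply: filterS2 n1 n2 => t a b ct.
  have := a ct; have := b ct; have /andP[_] := angle_bounds ct Py; rewrite /r; lra.
exists (Num.min e1 e2); first by rewrite lt_min e10.
move=> th cth; have := h1 th cth; have := h2 th cth.
have m1 : Num.min e1 e2 <= e1 by rewrite ge_min lexx.
have m2 : Num.min e1 e2 <= e2 by rewrite ge_min lexx orbT.
by move=> ? ?; split; lra.
Qed.

(** The ratio and its inverse have numerators below 2 pi and denominators above the gap [e]. The
    bound does not depend on [th], so the weights dominate the series of distances. *)
Lemma log_coord_bounded x : P x -> exists B, forall th, circle th -> `|log_coord th x| <= B.
Proof.
move=> Px; have [e e0 he] := uniform_gap Px; exists (ln (2 * pi / e)) => th cth.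
have [a b] := he _ cth; have [l0 lh h2] := inf_sup_angle_itv cth.
have pi0 := @pi_gt0 R.
have q0 : 0 < 2 * pi / e by apply: divr_gt0; lra.
have n0 : 0 < hh th x - inf_angle th by lra.
have d0 : 0 < sup_angle th - hh th x by lra.
have key (n d : R) : e < d -> 0 < n -> n < 2 * pi -> ln (n / d) <= ln (2 * pi / e).
  move=> ed n0' n2; have d0' : 0 < d by lra.
  rewrite ler_ln ?posrE//; last exact: divr_gt0.
  rewrite ler_pdivrMr// mulrAC ler_pdivlMr//.
  by apply: ler_pM; lra.
rewrite ler_norml; apply/andP; split; last by apply: key; lra.
rewrite lerNl /log_coord -lnV ?posrE; last exact: divr_gt0.
by rewrite invf_div; apply: key; lra.
Qed.

End Polygon.

(** * Convexity up to the boundary, and the lines through the sides *)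

Section Convexity.
Context {R : realType}.
Local Notation plane := (R * R)%type.
Implicit Types (x y z p q th xi eta rho v : plane) (c : set plane).
Variable C : set (set plane).
Hypothesis hC : curve_family C.
Local Notation hh := (proj_angle C).
Variables (P : set plane) (sides : seq (plane * plane)).
Hypothesis hP : convex_polygon C P sides.

(** A positive product expresses that a and b are strictly on the same side of c; in this form
    increasing and decreasing functions are treated alike. *)
Lemma mono_prod (k : R -> R) (a b c : R) :
  (forall s t, 0 <= s -> s < t -> t <= 1 -> k s < k t) \/
  (forall s t, 0 <= s -> s < t -> t <= 1 -> k t < k s) ->
  0 <= a <= 1 -> 0 <= b <= 1 -> 0 <= c <= 1 ->
  (0 < (k a - k c) * (k b - k c)) = (0 < (a - c) * (b - c)).
Proof.
move=> mono /andP[a0 a1] /andP[b0 b1] /andP[c0 c1].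
case: (ltgtP a c) => [ac|ac|->]; last by rewrite !subrr !mul0r.
  case: (ltgtP b c) => [bc|bc|->]; last by rewrite !subrr !mulr0.
    by case: mono => h; have := h _ _ a0 ac c1; have := h _ _ b0 bc c1 => ? ?;
      apply/idP/idP => _; nra.
  by case: mono => h; have := h _ _ a0 ac c1; have := h _ _ c0 bc b1 => ? ?;
    apply/idP/idP => ?; exfalso; nra.
case: (ltgtP b c) => [bc|bc|->]; last by rewrite !subrr !mulr0.
  by case: mono => h; have := h _ _ c0 ac a1; have := h _ _ b0 bc c1 => ? ?;
    apply/idP/idP => ?; exfalso; nra.
by case: mono => h; have := h _ _ c0 ac a1; have := h _ _ c0 bc b1 => ? ?;
  apply/idP/idP => _; nra.
Qed.

Lemma between_prod (s t u w : R) : 0 < (s - u) * (u - t) -> 0 < (w - u) * (t - u) ->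
  Num.min s w <= u <= Num.max s w.
Proof.
rewrite ge_min le_max; case: (ltgtP s u) => [su|su|->]; last by rewrite subrr mul0r ltxx.
  rewrite nmulr_rgt0 ?subr_lt0// => tu; rewrite pmulr_lgt0 ?subr_gt0//; lra.
rewrite pmulr_rgt0 ?subr_gt0// => tu; rewrite nmulr_lgt0 ?subr_lt0//; lra.
Qed.

Lemma convex_mem g c (s t u : R) : C c -> nparam g c -> 0 <= s <= 1 -> 0 <= t <= 1 ->
  Num.min s t <= u <= Num.max s t -> P (g s) -> P (g t) -> P (g u).
Proof.
have [_ _ _ cP _] := hP => Cc ng hs ht hu Ps Pt; apply: (cP (g s) (g t)) => //.
exists c, g, 0, 1, s, t, u; split => //; first exact: nparam_parametrizes.
Qed.

(** Restricted to interior parameters, so that curves ending at [th] are allowed as well. *)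
Lemma proj_angle_ivt g c th (a b r : R) : C c -> nparam g c -> circle th ->
  0 < a < 1 -> 0 < b < 1 -> Num.min (hh th (g a)) (hh th (g b)) <= r
    <= Num.max (hh th (g a)) (hh th (g b)) ->
  exists2 m, Num.min a b <= m <= Num.max a b & hh th (g m) = r.
Proof.
move=> Cc ng cth; wlog ab : a b / a <= b => [wl ha hb hr|].
  have /orP[ab|ba] := le_total a b; first exact: wl.
  have [|m hm mE] := wl b a ba hb ha; first by rewrite minC maxC.
  by exists m => //; rewrite minC maxC.
move=> ha hb hr; have [cg _ _ gd _] := ng.
have cont : {within `[a, b], continuous (hh th \o g)}.
  apply: continuous_in_subspaceT => t; rewrite inE /= in_itv /= => ht.
  apply: proj_angle_continuous_comp => //; first exact: cg.
  have t01 : 0 < t < 1 by lra.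
  have nd : \forall s \near t, disk (g s).
    by apply: cg; apply: open_nbhs_nbhs; split; [exact: disk_open|exact: gd].
  by apply: filterS nd => s; exact: disk_pdisk.
have [m hm mE] := IVT ab cont hr; exists m => //.
by rewrite (min_idPl ab) (max_idPr ab); move: hm; rewrite in_itv.
Qed.

Lemma proj_angle_near_side th v (r : R) : circle th -> disk v -> hh th v <> r ->
  \forall z \near v, disk z -> 0 < (hh th z - r) * (hh th v - r).
Proof.
move=> cth dv /eqP; rewrite neq_lt => /orP[] h.
  by apply: filterS (proj_angle_lt_near hC cth (disk_pdisk cth dv) h) => z hz /(disk_pdisk cth)/hz; nra.
by apply: filterS (proj_angle_gt_near hC cth (disk_pdisk cth dv) h) => z hz /(disk_pdisk cth)/hz; nra.
Qed.

(* With [p'] in P off the curve, every point of P close to [g t] lies on the same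
   side of the curve as [p']: otherwise the segment from [p'] to it would meet the
   curve in a point of P beyond [g u], and convexity would put [g u] in P. *)
Lemma opposite_side_missing g c (s t u : R) p' : C c -> nparam g c ->
  0 < s < 1 -> 0 < t < 1 -> 0 < u < 1 -> 0 < (s - u) * (u - t) ->
  P (g s) -> ~ P (g u) -> P p' -> hh (g 0) p' <> hh (g 0) (g s) ->
  \forall z \near g t, P z ->
    0 < (hh (g 0) z - hh (g 0) (g s)) * (hh (g 0) p' - hh (g 0) (g s)).
Proof.
move=> Cc ng hs ht hu sut Ps Pu Pp' np'.
have [cg _ [cth _] gd _] := ng; set th := g 0 in cth np' *; set ka := hh th (g s).
have hc : has_endpoints c th (g 1) by apply/has_endpointsP; exists g.
have kaE (w : R) : 0 < w < 1 -> hh th (g w) = ka.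
  by move=> hw; apply: (proj_angle_const hC Cc ng) => //; left.
have in01 (w : R) : 0 < w < 1 -> 0 <= w <= 1 by lra.
have onL z : disk z -> hh th z = ka -> c z.
  move=> dz; have <- : cw th (g 1) = ka.
    apply/esym/(proj_angle_line hC Cc hc); first by apply: disk_pdisk => //; exact: gd.
    exact: nparam_mem ng (in01 _ hs).
  by move/(proj_angle_line hC Cc hc (disk_pdisk cth dz)).
have dp' := polygon_disk hP Pp'; have du := gd _ hu.
have p'u : p' <> g u by move=> E; apply: np'; rewrite E kaE.
have [d [Cd dp du']] := curve_through hC dp' du p'u.
(* From the end [la], the points [p'] and [g u] have the same angle. This one level therefore tells
   both on which side of [g u] a point of c lies and on which side of [p'] a point of a segment from
   [p'] lies. *)
have [la [mu hd]] := curve_ends hC Cd.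
have [cla _ _ _ _] := has_endpoints_circle hd.
have hla : hh la p' = hh la (g u).
  transitivity (cw la mu); first by apply/(proj_angle_line hC Cd hd (disk_pdisk cla dp')).
  by apply/esym; apply/(proj_angle_line hC Cd hd (disk_pdisk cla du)).
have p'c : ~ c p'.
  move=> cp'; apply: np'; have [w hw wE] := nparam_ex ng cp'.
  by rewrite wE; apply: kaE; apply: nparam_disk ng hw _; rewrite -wE.
have nend w : has_endpoints c la w -> False.
  move=> hla'; apply: p'c.
  by rewrite (ray_uniq hC Cc Cd du (nparam_mem ng (in01 _ hu)) du' hla' hd).
have n0 : g 0 <> la by move=> E; apply: (nend (g 1)); rewrite -E.
have n1 : g 1 <> la.
  by move=> E; apply: (nend (g 0)); rewrite -E; exact: has_endpoints_sym.
have mono := proj_angle_mono hC Cc ng cla n0 n1.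
have claimA r : P r -> c r -> ~ 0 < (hh la r - hh la (g u)) * (hh la (g t) - hh la (g u)).
  move=> Pr /(nparam_ex ng)[w hw rE]; rewrite rE in Pr *.
  rewrite (@mono_prod (hh la \o g) w t u mono hw (in01 _ ht) (in01 _ hu)).
  move=> h; apply: Pu; apply: (convex_mem Cc ng (in01 _ hs) hw) => //.
  exact: between_prod sut h.
have tu : hh la (g t) <> hh la (g u).
  have : 0 < (t - u) * (t - u).
    rewrite -expr2 exprn_even_gt0//= subr_eq0; apply/eqP => E.
    by move: sut; rewrite E subrr mulr0 ltxx.
  rewrite -(@mono_prod (hh la \o g) t t u mono (in01 _ ht) (in01 _ ht) (in01 _ hu)) /=.
  by move=> + E; rewrite E subrr mul0r ltxx.
(* Being close to [g t] means here: seen from [la], on the same side of the level of [g u] as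
   [g t]. *)
have nn := proj_angle_near_side cla (gd _ ht) tu.
apply: filterS nn => z hz Pz.
have dz := polygon_disk hP Pz; have {}hz := hz dz.
have nc : ~ c z by move=> cz; exact: (claimA z Pz cz hz).
have zka : hh th z <> ka by move=> /(onL z dz).
rewrite ltNge; apply/negP => opp.
have p'z : p' <> z.
  move=> E; move: opp; rewrite -E.
  by move: np'; rewrite -/ka => /eqP; rewrite neq_lt => /orP[]; nra.
have [f [Cf fp fz]] := curve_through hC dp' dz p'z.
have [q nq] := curve_nparam hC Cf.
have [a ha aE] := nparam_ex nq fp; have [b hb bE] := nparam_ex nq fz.
have a01 : 0 < a < 1 by apply: nparam_disk nq ha _; rewrite -aE.
have b01 : 0 < b < 1 by apply: nparam_disk nq hb _; rewrite -bE.
have [|m hm mE] := @proj_angle_ivt q f th a b ka Cf nq cth a01 b01.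
  rewrite -aE -bE; move: np' zka opp; rewrite -/ka => /eqP np' /eqP zka opp.
  by case: (leP (hh th p') (hh th z)) => h; apply/andP; split; move: np' zka;
    rewrite !neq_lt => /orP[?|?] /orP[?|?]; nra.
have m01 : 0 < m < 1 by move: hm; case: (leP a b) => _; lra.
have Pm : P (q m) by apply: (convex_mem Cf nq ha hb) => //; rewrite -?aE -?bE.
have dm := polygon_disk hP Pm.
apply: (claimA (q m) Pm (onL _ dm mE)).
have ma : m <> a by move=> E; apply: np'; rewrite aE -E mE.
have nq0 : q 0 <> la.
  move=> E; have := proj_angle_const hC Cf nq (or_introl E) a01 b01; rewrite -aE -bE hla => E'.
  by move: hz; rewrite E' subrr mul0r ltxx.
have nq1 : q 1 <> la.
  move=> E; have := proj_angle_const hC Cf nq (or_intror E) a01 b01; rewrite -aE -bE hla => E'.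
  by move: hz; rewrite E' subrr mul0r ltxx.
have qmono := proj_angle_mono hC Cf nq cla nq0 nq1.
have := @mono_prod (hh la \o q) m b a qmono (in01 _ m01) hb ha.
rewrite /= -aE -bE hla => E.
have : 0 < (m - a) * (b - a).
  move/eqP: ma; rewrite neq_lt; move: hm.
  by case: (leP a b) => ab /andP[h1 h2] /orP[h|h]; nra.
rewrite -E => h1.
(* The crossing point [q m] is on the same side of the level as z, and z on the same side as [g t];
   multiplying the products and dividing by a square relates [q m] to [g t]. *)
have h2 : 0 < (hh la z - hh la (g u)) ^+ 2.
  by rewrite exprn_even_gt0//=; apply/eqP => E0; move: hz; rewrite E0 mul0r ltxx.
have h3 := mulr_gt0 h1 hz; rewrite -(pmulr_rgt0 _ h2).
by move: h3; congr (0 < _); ring.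
Qed.

(** P has points on both sides of the curve, by openness. If [g u] were missing from P, each of them
    would force the points of P near [g t] to its own side, but [g t] is in the closure of P. *)
Lemma open_segment g c (s t u : R) : C c -> nparam g c ->
  0 < s < 1 -> 0 < t < 1 -> 0 < u < 1 -> 0 < (s - u) * (u - t) ->
  P (g s) -> closure P (g t) -> P (g u).
Proof.
move=> Cc ng hs ht hu sut Ps clt; apply: contrapT => Pu.
have [_ _ [cth _] _ _] := ng.
have [p1 [p2 [P1 P2 /andP[h1 h2]]]] :=
  open_no_extremum hC (polygon_open hP) (polygon_disk hP) Ps cth.
have n1 : hh (g 0) p1 <> hh (g 0) (g s) by move=> E; move: h1; rewrite E ltxx.
have n2 : hh (g 0) p2 <> hh (g 0) (g s) by move=> E; move: h2; rewrite E ltxx.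
have a1 := opposite_side_missing Cc ng hs ht hu sut Ps Pu P1 n1.
have a2 := opposite_side_missing Cc ng hs ht hu sut Ps Pu P2 n2.
have [z [Pz [/(_ Pz) b1 /(_ Pz) b2]]] := clt _ (filterI a1 a2).
by nra.
Qed.

(** A point of P on the line of a side cannot be on the side, which is boundary. So one end of the
    side lies strictly between this point and the other end, which is in the closure of P, and
    [open_segment] puts a boundary point into P. *)
Lemma side_disjoint e c : e \in sides -> C c -> c e.1 -> c e.2 -> forall z, c z -> ~ P z.
Proof.
move=> es Cc c1 c2 z cz Pz; have [_ _ oP _ [sd bE]] := hP.
have [d1 d2 ne] := sd e es; have [g ng] := curve_nparam hC Cc.
have bnd w : seg C e.1 e.2 w -> closure P w /\ ~ P w.
  move=> sw; have : boundary P w by rewrite bE; exists e.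
  by move=> [cw' nw]; split => // Pw; apply: nw; rewrite (interior_id _).1.
have [s hs sE] := nparam_ex ng c1; have [t ht tE] := nparam_ex ng c2.
have [r hr rE] := nparam_ex ng cz.
have s01 : 0 < s < 1 by apply: nparam_disk ng hs _; rewrite -sE.
have t01 : 0 < t < 1 by apply: nparam_disk ng ht _; rewrite -tE.
have r01 : 0 < r < 1 by apply: nparam_disk ng hr _; rewrite -rE; exact: (polygon_disk hP).
have inseg w : Num.min s t <= w <= Num.max s t -> closure P (g w) /\ ~ P (g w).
  move=> hw; apply: bnd; exists c, g, 0, 1, s, t, w; split => //.
  exact: nparam_parametrizes.
have [cs Ps] : closure P (g s) /\ ~ P (g s) by apply: inseg; rewrite ge_min le_max lexx.
have [ct Pt] : closure P (g t) /\ ~ P (g t) by apply: inseg; rewrite ge_min le_max lexx !orbT.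
have st : s != t by apply/eqP => E; apply: ne; rewrite sE tE E.
have rn : ~~ (Num.min s t <= r <= Num.max s t).
  by apply/negP => /inseg[_]; apply; rewrite -rE.
rewrite rE in Pz.
have key : 0 < (r - s) * (s - t) \/ 0 < (r - t) * (t - s).
  move: rn st; case: (ltgtP s t) => // st /nandP[]; rewrite -ltNge => h _; [left|right|right|left]; nra.
case: key => key.
  by apply: Ps; exact: (open_segment Cc ng r01 t01 s01).
by apply: Pt; exact: (open_segment Cc ng r01 s01 t01).
Qed.

(** The line through the side containing v misses P, and by convexity P lies on one side of it; seen
    from an end of this line, its constant angle is thus an extremal angle of P. *)
Lemma boundary_extremal v : closure P v -> ~ P v ->
  exists e c, [/\ e \in sides, C c, c e.1, c e.2 &
    forall th xi, has_endpoints c th xi -> hh th v = inf_angle C P th \/ hh th v = sup_angle C P th].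
Proof.
move=> clv Pv; have [//|[e es sv]] := closure_polygon hP clv.
have dv := closure_polygon_disk hP clv.
case: sv => c [g [a [b [s [t [u [Cc pg [hs ht hu] [gs gt gu]]]]]]]].
have [ab _ _ _ [_ cE]] := pg.
have c1 : c e.1 by rewrite cE; exists s => //; move: hs.
have c2 : c e.2 by rewrite cE; exists t => //; move: ht.
have cv : c v.
  rewrite cE; exists u => //=; move: hs ht hu; rewrite !in_itv /=.
  by case: (leP s t) => _; lra.
exists e, c; split => // th xi hc.
have [cth _ _ _ _] := has_endpoints_circle hc.
have disj := side_disjoint es Cc c1 c2.
set ka := hh th v.
have kaE : ka = cw th xi by apply/(proj_angle_line hC Cc hc (disk_pdisk cth dv)).
have nka z : P z -> hh th z <> ka.
  move=> Pz E; apply: (disj z) => //.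
  by apply/(proj_angle_line hC Cc hc (disk_pdisk cth (polygon_disk hP Pz))); rewrite E.
have oneside x y : P x -> P y -> hh th x < ka -> ka < hh th y -> False.
  move=> Px Py hx hy.
  have xy : x <> y by move=> E; move: hx; rewrite E ltNge (ltW hy).
  have [d [Cd dx dy]] := curve_through hC (polygon_disk hP Px) (polygon_disk hP Py) xy.
  have [q nq] := curve_nparam hC Cd.
  have [s' hs' sE] := nparam_ex nq dx; have [t' ht' tE] := nparam_ex nq dy.
  have s01 : 0 < s' < 1 by apply: nparam_disk nq hs' _; rewrite -sE; exact: (polygon_disk hP).
  have t01 : 0 < t' < 1 by apply: nparam_disk nq ht' _; rewrite -tE; exact: (polygon_disk hP).
  have [|m hm mE] := @proj_angle_ivt q d th s' t' ka Cd nq cth s01 t01.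
    by rewrite -sE -tE ge_min le_max ltW//= (ltW hy) orbT.
  apply: (nka (q m)) => //; apply: (convex_mem Cd nq hs' ht') => //; by rewrite -?sE -?tE.
have /andP[l h] := angle_bounds_closure hC hP cth clv.
have [hinf hsup] := proj_angle_image_bounded hC hP cth.
have [[z0 Pz0] _ _ _ _] := hP.
have /eqP := nka z0 Pz0; rewrite neq_lt => /orP[z0k|z0k]; [right|left]; apply/eqP.
  rewrite eq_le h /=; apply: ge_sup; first by case: hsup.
  by move=> _ [z Pz <-]; rewrite leNgt; apply/negP => hz; exact: (oneside z0 z).
rewrite eq_le l andbT; apply: lb_le_inf; first by case: hinf.
by move=> _ [z Pz <-]; rewrite leNgt; apply/negP => hz; exact: (oneside z z0).
Qed.

End Convexity.

(** * The metric as a weighted series *)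

Lemma series_le_lim (R : realType) (f : R ^nat) (n : nat) :
  (forall i, 0 <= f i) -> cvgn (series f) -> series f n <= limn (series f).
Proof.
move=> f0 cf; apply: nondecreasing_cvgn_le => //.
by apply: nondecreasing_series => i _ _; exact: f0.
Qed.

Lemma term_le_lim (R : realType) (f : R ^nat) (n : nat) :
  (forall i, 0 <= f i) -> cvgn (series f) -> f n <= limn (series f).
Proof.
move=> f0 cf; apply: le_trans (series_le_lim n.+1 f0 cf); rewrite seriesSr.
by rewrite lerDr seriesEnat; apply: sumr_ge0.
Qed.

Section Metric.
Context {R : realType}.
Local Notation plane := (R * R)%type.
Implicit Types (x y z p q th xi eta rho v : plane) (c : set plane).
Variable C : set (set plane).
Hypothesis hC : curve_family C.
Local Notation hh := (proj_angle C).
Variables (P : set plane) (sides : seq (plane * plane)).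
Hypothesis hP : convex_polygon C P sides.
Variables (theta : nat -> plane) (w : nat -> R).
Hypothesis htheta : admissible_directions C sides theta.
Hypothesis hw : admissible_weights w.
Local Notation d := (dP C P theta w).
Local Notation u := (fun i => log_coord C P (theta i)).

Lemma theta_circle i : circle (theta i). Proof. by case: htheta. Qed.

Lemma w_gt0 i : 0 < w i. Proof. by case: hw. Qed.

Definition dist_term x y : R ^nat := fun i => w i * `|u i x - u i y|.

Local Notation gap := dist_term.

Lemma dist_term_ge0 x y i : 0 <= gap x y i.
Proof. by rewrite mulr_ge0// ltW// w_gt0. Qed.

Lemma dtermE x y : P x -> P y -> dterm C P theta w x y = gap x y.
Proof.
move=> Px Py; apply/funext => i; rewrite /dterm /dist_term (dthetaE hC hP)//; exact: theta_circle.
Qed.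

Lemma dist_term_cvg x y : P x -> P y -> cvgn (series (gap x y)).
Proof.
move=> Px Py; have [A hA] := log_coord_bounded hC hP Px; have [B hB] := log_coord_bounded hC hP Py.
have [_ cw'] := hw.
apply: (@series_le_cvg _ (gap x y) ((A + B) *: w)).
- exact: dist_term_ge0.
- move=> i; rewrite /GRing.scale /=; apply: mulr_ge0; last by rewrite ltW// w_gt0.
  apply: addr_ge0.
    exact: le_trans (normr_ge0 _) (hA _ (theta_circle i)).
  exact: le_trans (normr_ge0 _) (hB _ (theta_circle i)).
- move=> i; rewrite /dist_term [X in _ <= X]mulrC ler_wpM2l ?(ltW (w_gt0 _))//.
  apply: le_trans (ler_normB _ _) _; apply: lerD; [apply: hA|apply: hB]; exact: theta_circle.
exact: is_cvg_seriesZ.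
Qed.

Lemma dPE x y : P x -> P y -> d x y = limn (series (gap x y)).
Proof. by move=> Px Py; rewrite /dP dtermE. Qed.

Lemma dist_term_le_d x y i : P x -> P y -> gap x y i <= d x y.
Proof. by move=> Px Py; rewrite dPE//; apply: term_le_lim; [exact: dist_term_ge0|exact: dist_term_cvg]. Qed.

Lemma dP_ge0 x y : P x -> P y -> 0 <= d x y.
Proof. by move=> Px Py; exact: le_trans (dist_term_ge0 x y 0%N) (dist_term_le_d 0 Px Py). Qed.

Lemma dP_sym x y : P x -> P y -> d x y = d y x.
Proof.
move=> Px Py; rewrite !dPE//; congr (limn (series _)).
by apply/funext => i; rewrite /dist_term distrC.
Qed.

Lemma dP_refl x : P x -> d x x = 0.
Proof.
move=> Px; rewrite dPE// (_ : series (gap x x) = fun=> 0); first exact: lim_cst.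
apply/funext => n; rewrite seriesEnat /=; apply: big1 => i _.
by rewrite /dist_term subrr normr0 mulr0.
Qed.

Lemma dist_term_triangle x y z i : gap x z i <= gap x y i + gap y z i.
Proof. by rewrite /dist_term -mulrDr ler_wpM2l ?(ltW (w_gt0 _))// ler_distD. Qed.

(** The defect in the triangle inequality for d is the sum of the non-negative defects of the terms.
    So it is non-negative, and it vanishes only if all of them do. *)
Lemma slackE x y z : P x -> P y -> P z ->
  [/\ cvgn (series (gap x y + gap y z - gap x z)) &
     limn (series (gap x y + gap y z - gap x z)) = d x y + d y z - d x z].
Proof.
move=> Px Py Pz; rewrite (dPE Px Py) (dPE Py Pz) (dPE Px Pz).
move: (dist_term_cvg Px Py) (dist_term_cvg Py Pz) (dist_term_cvg Px Pz).
move: (gap x y) (gap y z) (gap x z) => f1 f2 f3 c1 c2 c3.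
have c12 : cvgn (series (f1 + f2)) by exact: is_cvg_seriesD.
split; first exact: is_cvg_seriesB.
by rewrite lim_seriesB// lim_seriesD.
Qed.

Lemma slack_ge0 x y z i : 0 <= (gap x y + gap y z - gap x z) i.
Proof. by rewrite /GRing.add /GRing.opp /= subr_ge0; exact: dist_term_triangle. Qed.

Lemma dP_triangle x y z : P x -> P y -> P z -> d x z <= d x y + d y z.
Proof.
move=> Px Py Pz; rewrite -subr_ge0; have [cs <-] := slackE Px Py Pz.
by apply: le_trans (term_le_lim 0 _ cs); [|move=> i]; exact: slack_ge0.
Qed.

Lemma dP_additive x y z : P x -> P y -> P z ->
  (forall i, `|u i x - u i z| = `|u i x - u i y| + `|u i y - u i z|) ->
  d x z = d x y + d y z.
Proof.
move=> Px Py Pz h; rewrite !dPE// -lim_seriesD; try exact: dist_term_cvg.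
congr (limn (series _)); apply/funext => i.
by rewrite /dist_term /GRing.add /= h mulrDr.
Qed.

Lemma dP_additive_inv x y z : P x -> P y -> P z -> d x z = d x y + d y z ->
  forall i, `|u i x - u i z| = `|u i x - u i y| + `|u i y - u i z|.
Proof.
move=> Px Py Pz E i; apply/eqP; rewrite eq_le ler_distD /=.
have [cs lE] := slackE Px Py Pz.
have := term_le_lim i (slack_ge0 x y z) cs; rewrite lE E subrr.
rewrite /GRing.add /GRing.opp /= /dist_term subr_le0 -mulrDr.
by rewrite ler_pM2l// w_gt0.
Qed.

Lemma theta_dense th (A : set plane) : circle th -> nbhs th A -> exists i, A (theta i).
Proof.
move=> cth nA; have [_ dn _] := htheta.
by have [_ [[i _ <-] Ai]] := dn th cth _ nA; exists i.
Qed.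

Lemma dP_eq0 x y : P x -> P y -> d x y = 0 -> x = y.
Proof.
move=> Px Py E; apply: contrapT => xy.
have dx := polygon_disk hP Px; have dy := polygon_disk hP Py.
have [c [Cc cx cy]] := curve_through hC dx dy xy.
have [al [be hc]] := curve_ends hC Cc.
have [cal cbe ne _ _] := has_endpoints_circle hc.
have ne' : be <> al by move/esym.
have b0 := cw_gt0 cal cbe ne'; have /andP[_ b2] := cw_itv cal cbe.
(* A boundary point different from both ends of the curve; by density some [theta i] near it also
   avoids both ends, and the angle from there separates x and y. *)
have [ga [cga n1 gaE]] := @cw_between _ al (cw al be / 2) cal ltac:(lra).
have n2 : ga <> be by move=> Eg; move: gaE; rewrite Eg; lra.
have nA : \forall t \near ga, t <> al /\ t <> be by apply: filterI; exact: neq_near.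
have [i [i1 i2]] := theta_dense cga nA.
move: (hc) => /has_endpointsP[g [ng g0 g1]].
have m0 : g 0 <> theta i by rewrite g0 => /esym.
have m1 : g 1 <> theta i by rewrite g1 => /esym.
have [s hs sE] := nparam_ex ng cx; have [t ht tE] := nparam_ex ng cy.
have inj := proj_angle_curve_inj hC Cc ng (theta_circle i) m0 m1.
have hne : hh (theta i) x <> hh (theta i) y.
  move=> E'; apply: xy; rewrite sE tE; congr g; apply: inj; rewrite ?in_itv//=.
  by rewrite -sE -tE.
have := dist_term_le_d i Px Py; rewrite E /dist_term pmulr_rle0 ?w_gt0// normr_le0 subr_eq0.
by rewrite eq_le !(log_coord_mono hC hP)//; try exact: theta_circle; rewrite -eq_le => /eqP.
Qed.

Lemma dP_metric : is_metric_on P d.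
Proof.
split.
- exact: dP_ge0.
- by move=> x y Px Py; split; [exact: dP_eq0|move=> <-; exact: dP_refl].
- exact: dP_sym.
- exact: dP_triangle.
Qed.

(** From the end [al] of c, the points x and y have the same angle. If z had another one, some
    [theta i] near [al] would see x and y strictly on the same side of z, and the coordinate of z
    would not lie between theirs. *)
Lemma dP_collinear c x y z : C c -> c x -> c y -> P x -> P y -> P z -> x <> y ->
  d x y = d x z + d z y -> c z.
Proof.
move=> Cc cx cy Px Py Pz xy E; have bet := dP_additive_inv Px Pz Py E.
have dx := polygon_disk hP Px; have dy := polygon_disk hP Py; have dz := polygon_disk hP Pz.
have [al [be hc]] := curve_ends hC Cc.
have [cal _ _ _ _] := has_endpoints_circle hc.
apply/(proj_angle_line hC Cc hc (disk_pdisk cal dz)).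
have hx : hh al x = cw al be by apply/(proj_angle_line hC Cc hc (disk_pdisk cal dx)).
have hy : hh al y = cw al be by apply/(proj_angle_line hC Cc hc (disk_pdisk cal dy)).
apply/eqP; case: ltgtP => // hz; exfalso.
  pose r := (hh al z + cw al be) / 2.
  have n1 := @proj_angle_dir_lt_near _ _ hC al z r cal dz ltac:(rewrite /r; lra).
  have n2 := @proj_angle_dir_gt_near _ _ hC al x r cal dx ltac:(rewrite hx /r; lra).
  have n3 := @proj_angle_dir_gt_near _ _ hC al y r cal dy ltac:(rewrite hy /r; lra).
  have [i [[]]] := theta_dense cal (filterI (filterI n1 n2) n3).
  have ci := theta_circle i; move=> /(_ ci) a /(_ ci) b /(_ ci) e.
  have zx : u i z < u i x by rewrite ltNge (log_coord_mono hC hP)// -ltNge; lra.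
  have zy : u i z < u i y by rewrite ltNge (log_coord_mono hC hP)// -ltNge; lra.
  have := bet i; rewrite (@gtr0_norm _ (u i x - u i z)) ?subr_gt0//.
  rewrite (@ltr0_norm _ (u i z - u i y)) ?subr_lt0//.
  have : `|u i x - u i y| < u i x - u i z + - (u i z - u i y).
    by rewrite ltr_norml; apply/andP; split; lra.
  by move=> + E'; rewrite E' ltxx.
pose r := (hh al z + cw al be) / 2.
have n1 := @proj_angle_dir_gt_near _ _ hC al z r cal dz ltac:(rewrite /r; lra).
have n2 := @proj_angle_dir_lt_near _ _ hC al x r cal dx ltac:(rewrite hx /r; lra).
have n3 := @proj_angle_dir_lt_near _ _ hC al y r cal dy ltac:(rewrite hy /r; lra).
have [i [[]]] := theta_dense cal (filterI (filterI n1 n2) n3).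
have ci := theta_circle i; move=> /(_ ci) a /(_ ci) b /(_ ci) e.
have zx : u i x < u i z by rewrite ltNge (log_coord_mono hC hP)// -ltNge; lra.
have zy : u i y < u i z by rewrite ltNge (log_coord_mono hC hP)// -ltNge; lra.
have := bet i; rewrite (@ltr0_norm _ (u i x - u i z)) ?subr_lt0//.
rewrite (@gtr0_norm _ (u i z - u i y)) ?subr_gt0//.
have : `|u i x - u i y| < - (u i x - u i z) + (u i z - u i y).
  by rewrite ltr_norml; apply/andP; split; lra.
by move=> + E'; rewrite E' ltxx.
Qed.

End Metric.

(** * The metric along a curve: additivity, continuity, unboundedness *)

Section Geodesics.
Context {R : realType}.
Local Notation plane := (R * R)%type.
Implicit Types (x y z p q th xi eta rho v : plane) (c : set plane).
Variable C : set (set plane).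
Hypothesis hC : curve_family C.
Local Notation hh := (proj_angle C).
Variables (P : set plane) (sides : seq (plane * plane)).
Hypothesis hP : convex_polygon C P sides.
Variables (theta : nat -> plane) (w : nat -> R).
Hypothesis htheta : admissible_directions C sides theta.
Hypothesis hw : admissible_weights w.
Local Notation d := (dP C P theta w).
Local Notation u := (fun i => log_coord C P (theta i)).
Local Notation gap := (dist_term C P theta w).

Lemma log_coord_curve_additive c g th (s t v : R) : C c -> nparam g c -> circle th ->
  0 < s < 1 -> 0 < t < 1 -> 0 < v < 1 -> P (g s) -> P (g t) -> P (g v) ->
  s <= t <= v ->
  `|log_coord C P th (g s) - log_coord C P th (g v)| =
  `|log_coord C P th (g s) - log_coord C P th (g t)| +
  `|log_coord C P th (g t) - log_coord C P th (g v)|.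
Proof.
move=> Cc ng cth hs ht hv Ps Pt Pv /andP[st tv].
have um := log_coord_mono hC hP cth.
suff [[a b]|[a b]] :
    (hh th (g s) <= hh th (g t) /\ hh th (g t) <= hh th (g v)) \/
    (hh th (g t) <= hh th (g s) /\ hh th (g v) <= hh th (g t)).
- rewrite -um// in a; rewrite -um// in b.
  by rewrite !ler0_norm ?subr_le0//; [lra|exact: le_trans b].
- rewrite -um// in a; rewrite -um// in b.
  by rewrite !ger0_norm ?subr_ge0//; [lra|exact: le_trans a].
have [e|[g0 g1]] : (g 0 = th \/ g 1 = th) \/ (g 0 <> th /\ g 1 <> th).
  by have [?|?] := pselect (g 0 = th); have [?|?] := pselect (g 1 = th); tauto.
  by left; rewrite (proj_angle_const hC Cc ng e ht hs) (proj_angle_const hC Cc ng e hv hs).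
have le_of (k : R -> R) a b : (forall s t, 0 <= s -> s < t -> t <= 1 -> k s < k t) ->
    0 < a < 1 -> 0 < b < 1 -> a <= b -> k a <= k b.
  move=> h ha hb; rewrite le_eqVlt => /orP[/eqP ->//|ab]; apply/ltW/h => //; lra.
have [h|h] := proj_angle_mono hC Cc ng cth g0 g1; [left|right].
  by split; apply: (le_of (hh th \o g)).
have h' s1 t1 : 0 <= s1 -> s1 < t1 -> t1 <= 1 -> - hh th (g s1) < - hh th (g t1).
  by move=> *; rewrite ltrN2; exact: h.
by split; rewrite -lerN2; [exact: (le_of _ _ _ h' hs ht)|exact: (le_of _ _ _ h' ht hv)].
Qed.

Lemma dP_curve_additive c g (s t v : R) : C c -> nparam g c ->
  0 < s < 1 -> 0 < t < 1 -> 0 < v < 1 -> P (g s) -> P (g t) -> P (g v) ->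
  s <= t <= v -> d (g s) (g v) = d (g s) (g t) + d (g t) (g v).
Proof.
move=> Cc ng hs ht hv Ps Pt Pv stv; apply: (dP_additive hC hP htheta hw) => // i.
by apply: (log_coord_curve_additive Cc ng) => //; exact: (theta_circle htheta).
Qed.

Lemma log_coord_continuous th (g : R -> plane) t : circle th -> {for t, continuous g} ->
  P (g t) -> {for t, continuous (log_coord C P th \o g)}.
Proof.
move=> cth cg Pt; have /andP[l h] := angle_bounds hC hP cth Pt.
have ch : {for t, continuous (hh th \o g)}.
  apply: proj_angle_continuous_comp => //.
  have nP : \forall s \near t, P (g s).
    by apply: cg; apply: open_nbhs_nbhs; split => //; exact: (polygon_open hP).
  by apply: filterS nP => s /(polygon_disk hP); exact: disk_pdisk.
apply: (@cvg_comp _ _ _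
  (fun s => (hh th (g s) - inf_angle C P th) / (sup_angle C P th - hh th (g s))) (@ln R)
  _ (nbhs ((hh th (g t) - inf_angle C P th) / (sup_angle C P th - hh th (g t))))).
  apply: cvgM; first by apply: cvgB; [exact: ch|exact: cvg_cst].
  apply: cvgV; first by rewrite gt_eqF// subr_gt0.
  by apply: cvgB; [exact: cvg_cst|exact: ch].
by apply: continuous_ln; apply: divr_gt0; rewrite subr_gt0.
Qed.

Lemma finite_gap_near (g : R -> plane) t n (e : R) : continuous g -> P (g t) -> 0 < e ->
  \forall s \near t, series (gap (g t) (g s)) n < e.
Proof.
move=> cg Pt; elim: n e => [|n IH] e e0.
  by near=> s; rewrite seriesEnat /= big_geq.
have e20 : 0 < e / 2 by lra.
have wn := w_gt0 hw n.
have := log_coord_continuous (theta_circle htheta n) (cg t) Pt => /cvgrPdist_lt.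
move=> /(_ (e / 2 / w n)); rewrite divr_gt0// => /(_ isT) n1.
apply: filterS2 (IH _ e20) n1 => s a b; rewrite seriesSr /dist_term.
have : w n * `|u n (g t) - u n (g s)| < e / 2 by rewrite mulrC -ltr_pdivlMr.
by move: a; rewrite /dist_term; lra.
Unshelve. all: by end_near. Qed.

(* Monotonicity along the curve dominates the terms of d (g t) (g s), for s
   between a and b, by those of d (g t) (g a) + d (g t) (g b). *)
Lemma dP_curve_continuous c g (a b t e : R) : C c -> nparam g c ->
  0 < a -> a < t -> t < b -> b < 1 -> P (g a) -> P (g t) -> P (g b) -> 0 < e ->
  \forall s \near t, d (g t) (g s) < e.
Proof.
move=> Cc ng a0 at_ tb b1 Pa Pt Pb e0.
pose M := gap (g t) (g a) + gap (g t) (g b).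
have cM : cvgn (series M) by apply: is_cvg_seriesD; exact: (dist_term_cvg hC hP htheta hw).
(* After [n] terms the remainder of the dominating series is below [e / 2]; the finite sum of the
   first [n] terms is small by continuity. *)
have [n hn] : exists n, limn (series M) - e / 2 < series M n.
  have : \forall n \near \oo, limn (series M) - e / 2 < series M n.
    by move: (cM) => /cvgr_gt; apply; lra.
  by move=> [n _ /(_ n (leqnn _))]; exists n.
have [cg _ _ _ _] := ng.
have sa : \forall s \near t, a < s by exact: lt_nbhsr.
have sb : \forall s \near t, s < b by exact: lt_nbhsl.
have e20 : 0 < e / 2 by lra.
apply: filterS3 sa sb (finite_gap_near n cg Pt e20) => s as_ {}sb hs.
have Ps : P (g s).
  apply: (convex_mem hP Cc ng (_ : 0 <= a <= 1) (_ : 0 <= b <= 1)) => //; try lra.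
  by rewrite (min_idPl _) ?(max_idPr _); lra.
have leM i : gap (g t) (g s) i <= M i.
  rewrite /M /GRing.add /= /dist_term -mulrDr ler_wpM2l ?(ltW (w_gt0 hw i))//.
  have ci := theta_circle htheta i.
  pose U := log_coord C P (theta i); rewrite -/(U _) -/(U (g s)) -/(U (g a)) -/(U (g b)).
  have [ts|st] := leP t s.
    have -> : `|U (g t) - U (g b)| = `|U (g t) - U (g s)| + `|U (g s) - U (g b)|.
      by apply: (log_coord_curve_additive Cc ng ci) => //; lra.
    by rewrite addrCA lerDl addr_ge0.
  have E : `|U (g a) - U (g t)| = `|U (g a) - U (g s)| + `|U (g s) - U (g t)|.
    by apply: (log_coord_curve_additive Cc ng ci) => //; lra.
  rewrite [`|U (g t) - U (g a)|]distrC E [`|U (g t) - U (g s)|]distrC.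
  by rewrite [X in _ <= X + _]addrC -addrA lerDl addr_ge0.
have cD := dist_term_cvg hC hP htheta hw Pt Ps.
(* The remainder of the series of [d (g t) (g s)] is at most that of M. *)
have : series (M - gap (g t) (g s)) n <= limn (series (M - gap (g t) (g s))).
  apply: series_le_lim; last exact: is_cvg_seriesB.
  by move=> i; rewrite /GRing.add /GRing.opp /= subr_ge0; exact: leM.
rewrite lim_seriesB// -(dPE hC hP w htheta Pt Ps).
have -> : series (M - gap (g t) (g s)) n = series M n - series (gap (g t) (g s)) n.
  by rewrite seriesD seriesN.
by lra.
Qed.

(** The exit parameter is the supremum of the parameters t >= t0 with [g t] in P. It is smaller than
    1 because the closure of P stays in the open disk. *)
Lemma exit_right c g (t0 : R) : C c -> nparam g c -> 0 < t0 < 1 -> P (g t0) ->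
  exists b, [/\ t0 < b < 1, closure P (g b), ~ P (g b) &
    forall t, t0 <= t < b -> P (g t)].
Proof.
move=> Cc ng t01 Pt0; have [cg _ _ _ _] := ng.
pose A := [set t | t0 <= t <= 1 /\ P (g t)].
have At0 : A t0 by split => //; rewrite lexx /=; lra.
have hA : has_sup A by split; [exists t0|exists 1 => t [/andP[]]].
pose b := sup A.
have tb : t0 <= b by apply: ub_le_sup => //; case: hA.
have b1 : b <= 1 by apply: ge_sup; [case: hA|move=> t [/andP[]]].
have clb : closure P (g b).
  move=> B nB; have nb : \forall t \near b, B (g t) by exact: cg.
  move: nb => /nbhs_ballP[e /= e0 be].
  have [t At bt] := sup_adherent e0 hA.
  exists (g t); split; first by case: At.
  apply: be; rewrite /ball /= ger0_norm; first by rewrite /b; lra.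
  by rewrite subr_ge0; apply: ub_le_sup => //; case: hA.
have db := closure_polygon_disk hP clb.
have b01 : 0 < b < 1 by apply: nparam_disk ng _ db; lra.
have Pb : ~ P (g b).
  move=> Pb; have nb : \forall t \near b, P (g t).
    by apply: cg; apply: open_nbhs_nbhs; split => //; exact: (polygon_open hP).
  move: nb => /nbhs_ballP[e /= e0 be].
  pose dl := Num.min (e / 2) (1 - b).
  have dl0 : 0 < dl by rewrite lt_min; lra.
  have dle : dl <= e / 2 by rewrite ge_min lexx.
  have dl1 : dl <= 1 - b by rewrite ge_min lexx orbT.
  have : A (b + dl).
    split; first by lra.
    by apply: be; rewrite /ball /= opprD addrA subrr sub0r normrN gtr0_norm//; lra.
  move=> Ab; have : b + dl <= b by apply: ub_le_sup => //; case: hA.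
  by lra.
exists b; split => //.
  rewrite lt_neqAle tb andbT; case/andP: b01 => _ ->; rewrite andbT.
  by apply/eqP => E; apply: Pb; rewrite -E.
move=> t /andP[t0t tb'].
have e0 : 0 < b - t by lra.
have [s [/andP[s0 s1] Ps] bs] := sup_adherent e0 hA.
have ts : t < s by move: bs; rewrite -/b; lra.
apply: (convex_mem hP Cc ng (_ : 0 <= t0 <= 1) (_ : 0 <= s <= 1)) => //; try lra.
by rewrite (min_idPl _) ?(max_idPr _); lra.
Qed.

(** [r] solves [(r - inf) / (sup - r) = E], that is, it inverts the logit; the equivalences
    translate bounds on the coordinate into bounds on the angle. *)
Lemma log_coord_value th (h E : R) : circle th -> inf_angle C P th < h < sup_angle C P th -> 0 < E ->
  let r := (inf_angle C P th + E * sup_angle C P th) / (1 + E) in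
  [/\ inf_angle C P th < r < sup_angle C P th, (r - inf_angle C P th) / (sup_angle C P th - r) = E,
      (h <= r) = (ln ((h - inf_angle C P th) / (sup_angle C P th - h)) <= ln E) &
      (r <= h) = (ln E <= ln ((h - inf_angle C P th) / (sup_angle C P th - h)))].
Proof.
move=> cth /andP[lh hhi] E0; move: (inf_angle C P th) (sup_angle C P th) lh hhi => l k lh hk r.
have E1 : 0 < 1 + E by lra.
have rl : r - l = E * (k - l) / (1 + E).
  by rewrite /r; field; rewrite gt_eqF.
have kr : k - r = (k - l) / (1 + E).
  by rewrite /r; field; rewrite gt_eqF.
have rl0 : 0 < r - l by rewrite rl divr_gt0// mulr_gt0//; lra.
have kr0 : 0 < k - r by rewrite kr divr_gt0//; lra.
have q0 : 0 < (h - l) / (k - h) by apply: divr_gt0; lra.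
have q1 : 0 < (k - h) by lra.
split; first by lra.
- by rewrite rl kr; field; rewrite !gt_eqF//; lra.
- rewrite ler_ln ?posrE// ler_pdivrMr// /r ler_pdivlMr//.
  by apply/idP/idP => ?; lra.
rewrite ler_ln ?posrE// ler_pdivlMr// /r ler_pdivrMr//.
by apply/idP/idP => ?; lra.
Qed.

(** Instead of a limit at the exit point, a point is found where the coordinate from the direction
    [theta i] of the side differs from that of [g t0] by exactly [B / w i]; this single term of d
    already equals B. *)
Lemma unbounded_right c g (t0 B : R) : C c -> nparam g c -> 0 < t0 < 1 -> P (g t0) ->
  0 <= B -> exists t, [/\ t0 <= t < 1, P (g t) & B <= d (g t0) (g t)].
Proof.
move=> Cc ng t01 Pt0 B0.
have [b [/andP[tb b1] clb Pb Pin]] := exit_right Cc ng t01 Pt0.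
have [e [c' [es Cc' c1 c2 hext]]] := boundary_extremal hC hP clb Pb.
have [th [xi hc']] := curve_ends hC Cc'.
have [_ _ hside] := htheta.
have [i _ thE] : range theta th by apply: (hside e c') => //; exists xi.
have cth : circle th by have [] := has_endpoints_circle hc'.
have wi := w_gt0 hw i.
have b01 : 0 < b < 1 by lra.
have hh0 := angle_bounds hC hP cth Pt0.
have finish (K : R) : `|log_coord C P th (g t0) - K| = B / w i ->
    Num.min (hh th (g t0)) (hh th (g b)) <=
      (inf_angle C P th + expR K * sup_angle C P th) / (1 + expR K) <=
      Num.max (hh th (g t0)) (hh th (g b)) ->
    exists t, [/\ t0 <= t < 1, P (g t) & B <= d (g t0) (g t)].
  move=> KB; have [rin rE _ _] := log_coord_value cth hh0 (expR_gt0 K).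
  move: (_ / (1 + expR K)) rin rE => r rin rE hr.
  have [m hm mE] := @proj_angle_ivt _ _ hC g c th t0 b r Cc ng cth t01 b01 hr.
  (* At the exit point the angle is extremal, whereas [r] lies strictly between the extremal
     angles. *)
  have mb : m <> b.
    move=> E; rewrite E in mE; case: (hext _ _ hc') => E'; move: rin; rewrite -mE E'; lra.
  have tm : t0 <= m < b.
    move: hm; rewrite (min_idPl (ltW tb)) (max_idPr (ltW tb)) => /andP[h1 h2].
    by rewrite h1 lt_neqAle h2 andbT; apply/eqP.
  have Pm := Pin m tm.
  exists m; split => //; first by lra.
  apply: le_trans (dist_term_le_d hC hP htheta hw i Pt0 Pm); rewrite /dist_term thE.
  have -> : log_coord C P th (g m) = K by rewrite /log_coord mE rE expRK.
  by rewrite KB mulrC divfK// gt_eqF.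
have Bw : 0 <= B / w i by rewrite divr_ge0// ltW.
have [hb|hb] := hext _ _ hc'.
  apply: (finish (log_coord C P th (g t0) - B / w i)).
    by rewrite opprB addrC subrK ger0_norm.
  have [/andP[r1 r2] _ _ h2] := log_coord_value cth hh0 (expR_gt0 (log_coord C P th (g t0) - B / w i)).
  rewrite hb (min_idPr (ltW (andP hh0).1)) (max_idPl (ltW (andP hh0).1)) (ltW r1) /=.
  by rewrite h2 expRK /log_coord gerBl.
apply: (finish (log_coord C P th (g t0) + B / w i)).
  by rewrite opprD addrA subrr sub0r normrN ger0_norm.
have [/andP[r1 r2] _ h2 _] := log_coord_value cth hh0 (expR_gt0 (log_coord C P th (g t0) + B / w i)).
rewrite hb (min_idPl (ltW (andP hh0).2)) (max_idPr (ltW (andP hh0).2)) (ltW r2) andbT.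
by rewrite h2 expRK /log_coord lerDl.
Qed.

End Geodesics.

(** * Geodesic lines, geodesic segments and their uniqueness *)

Section GeodesicLines.
Context {R : realType}.
Local Notation plane := (R * R)%type.
Implicit Types (x y z p q th xi eta rho : plane) (c : set plane).
Variable C : set (set plane).
Hypothesis hC : curve_family C.
Variables (P : set plane) (sides : seq (plane * plane)).
Hypothesis hP : convex_polygon C P sides.
Variables (theta : nat -> plane) (w : nat -> R).
Hypothesis htheta : admissible_directions C sides theta.
Hypothesis hw : admissible_weights w.
Local Notation d := (dP C P theta w).

Lemma open_param_interval c g t : nparam g c -> 0 < t < 1 -> P (g t) ->
  exists a b, [/\ 0 < a, a < t, t < b & b < 1] /\ P (g a) /\ P (g b).
Proof.
move=> ng t01 Pt; have [cg _ _ _ _] := ng.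
have nb : \forall s \near t, P (g s).
  by apply: cg; apply: open_nbhs_nbhs; split => //; exact: (polygon_open hP).
move: nb => /nbhs_ballP[e /= e0 be].
pose dl := Num.min (e / 2) (Num.min (t / 2) ((1 - t) / 2)).
have d0 : 0 < dl by rewrite !lt_min; lra.
have de : dl <= e / 2 by rewrite ge_min lexx.
have dt : dl <= t / 2 by rewrite !ge_min lexx !orbT.
have d1 : dl <= (1 - t) / 2 by rewrite !ge_min lexx !orbT.
exists (t - dl), (t + dl); split; first by split; lra.
split; apply: be; rewrite /ball /=.
  by rewrite opprB addrC subrK gtr0_norm//; lra.
by rewrite opprD addrA subrr sub0r normrN gtr0_norm//; lra.
Qed.

(** The signed distance [phi] from [g t0] is isometric by additivity, and onto the real line because
    it is continuous and unbounded in both directions. The required map is g composed with its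
    inverse. *)
Lemma curve_geodesic c g (t0 : R) : C c -> nparam g c -> 0 < t0 < 1 -> P (g t0) ->
  exists2 F, isometric_on P d setT F & range F = c `&` P.
Proof.
move=> Cc ng t01 Pt0.
pose T t := 0 < t < 1 /\ P (g t).
have Tt0 : T t0 by [].
have Tconv a b s : T a -> T b -> a <= s <= b -> T s.
  move=> [a01 Pa] [b01 Pb] sab; split; first by lra.
  apply: (convex_mem hP Cc ng (_ : 0 <= a <= 1) (_ : 0 <= b <= 1)) => //; try lra.
  by rewrite (min_idPl _) ?(max_idPr _); lra.
have add s t v : T s -> T t -> T v -> s <= t -> t <= v ->
    d (g s) (g v) = d (g s) (g t) + d (g t) (g v).
  move=> [s1 Ps] [t1 Pt] [v1 Pv] st tv.
  by apply: (dP_curve_additive hC hP htheta hw Cc ng) => //; rewrite st.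
have dsym s t : T s -> T t -> d (g s) (g t) = d (g t) (g s).
  by move=> [_ Ps] [_ Pt]; exact: (dP_sym hC hP w htheta).
pose phi t := if t0 <= t then d (g t0) (g t) else - d (g t0) (g t).
have phiB s t : T s -> T t -> s <= t -> phi t - phi s = d (g s) (g t).
  move=> Ts Tt st; rewrite /phi; have [t0s|st0] := leP t0 s.
    by rewrite (le_trans t0s st) (add t0 s t)//; lra.
  have [t0t|tt0] := leP t0 t.
    by rewrite opprK (add s t0 t) ?(ltW st0)// (dsym s t0)//; lra.
  rewrite opprK (dsym t0 s)// (add s t t0) ?(ltW tt0)// (dsym t0 t)//; lra.
have phiN s t : T s -> T t -> d (g s) (g t) = `|phi s - phi t|.
  move=> Ts Tt; case: (Ts) (Tt) => [_ Ps] [_ Pt].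
  have [st|/ltW ts] := leP s t.
    by rewrite distrC (phiB s t)// ger0_norm// (dP_ge0 hC hP htheta hw).
  by rewrite (phiB t s)// ger0_norm ?(dP_ge0 hC hP htheta hw)// dsym.
have phi_inj s t : T s -> T t -> phi s = phi t -> s = t.
  move=> Ts Tt E; case: (Ts) (Tt) => [s1 Ps] [t1 Pt].
  have : d (g s) (g t) = 0 by rewrite phiN// E subrr normr0.
  move=> /(dP_eq0 hC hP htheta hw Ps Pt)/(nparam_inj ng); apply; lra.
have phi_cont t : T t -> {for t, continuous phi}.
  move=> Tt; have [t1 Pt] := Tt.
  have [a [b [[a0 at_ tb b1] [Pa Pb]]]] := open_param_interval ng t1 Pt.
  have Ta : T a by split => //; lra.
  have Tb : T b by split => //; lra.
  apply/cvgrPdist_lt => e e0.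
  apply: filterS3 (lt_nbhsr at_) (lt_nbhsl tb)
    (dP_curve_continuous hC hP htheta hw Cc ng a0 at_ tb b1 Pa Pt Pb e0) => s as_ sb.
  by rewrite phiN//; apply: (Tconv a b) => //; rewrite !ltW.
have phi_surj r : exists t, T t /\ phi t = r.
  have r0 := normr_ge0 r.
  have [t2 [/andP[h2 h2'] P2 B2]] := unbounded_right hC hP htheta hw Cc ng t01 Pt0 r0.
  (* The other direction along c is obtained from the reversed parametrization. *)
  have t01' : 0 < 1 - t0 < 1 by lra.
  have := @unbounded_right _ _ hC _ _ hP _ _ htheta hw c _ (1 - t0) `|r| Cc (nparam_rev ng) t01'.
  rewrite /= subKr => /(_ Pt0 r0)[t1' [h1 P1 B1]].
  set t1 := 1 - t1' in P1 B1.
  have T2 : T t2 by split => //; lra.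
  have T1 : T t1 by split => //; rewrite /t1; lra.
  have t1t0 : t1 <= t0 by rewrite /t1; lra.
  have p2 : `|r| <= phi t2 by rewrite /phi h2.
  have p1 : phi t1 <= - `|r|.
    have p0 : phi t0 = 0 by rewrite /phi lexx (dP_refl hC hP w htheta).
    by have := phiB _ _ T1 Tt0 t1t0; rewrite p0 dsym// => E; move: B1; rewrite -E; lra.
  have t12 : t1 <= t2 by lra.
  have cont : {within `[t1, t2], continuous phi}.
    apply: continuous_in_subspaceT => t; rewrite inE /= in_itv /= => ht.
    by apply: phi_cont; exact: (Tconv t1 t2).
  have hr : Num.min (phi t1) (phi t2) <= r <= Num.max (phi t1) (phi t2).
    have := ler_norm r; have := ler_norm (- r); rewrite normrN => ? ?.
    by rewrite ge_min le_max; apply/andP; split; apply/orP; [left|right]; lra.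
  have [t ht tE] := IVT t12 cont hr; exists t; split => //.
  by apply: (Tconv t1 t2) => //; move: ht; rewrite in_itv.
have /choice[tr htr] := phi_surj.
exists (g \o tr).
  split => [r _|r s _ _] /=; first by have [[]] := htr r.
  by have [Tr Er] := htr r; have [Ts Es] := htr s; rewrite phiN// Er Es.
apply/seteqP; split => z.
  move=> [r _ <-] /=; have [[t1 Pt] _] := htr r; split => //.
  by apply: nparam_mem ng _; lra.
move=> [cz Pz]; have [t ht zE] := nparam_ex ng cz.
have Tt : T t.
  by split; [apply: nparam_disk ng ht _; rewrite -zE; exact: (polygon_disk hP)|rewrite -zE].
exists (phi t) => //=; have [Ts Es] := htr (phi t).
by rewrite zE; congr g; exact: phi_inj.
Qed.

Lemma geodesic_of_curve c x : C c -> c x -> P x ->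
  exists2 F, isometric_on P d setT F & range F = c `&` P.
Proof.
move=> Cc cx Px; have [g ng] := curve_nparam hC Cc.
have [t ht xE] := nparam_ex ng cx.
have t01 : 0 < t < 1.
  by apply: nparam_disk ng ht _; rewrite -xE; exact: (polygon_disk hP).
by apply: (curve_geodesic Cc ng t01); rewrite -xE.
Qed.

Lemma geodesic_through x y : P x -> P y -> x <> y ->
  exists c F, [/\ C c, c x, c y, isometric_on P d setT F & range F = c `&` P].
Proof.
move=> Px Py xy.
have [c [Cc cx cy]] := curve_through hC (polygon_disk hP Px) (polygon_disk hP Py) xy.
by have [F iF rF] := geodesic_of_curve Cc cx Px; exists c, F.
Qed.

Lemma geodesic_segment_ex x y : P x -> P y -> exists S, geodesic_segment P d x y S.
Proof.
move=> Px Py; have [<-|xy] := pselect (x = y).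
  exists ((fun=> x) @` `[0 : R, 0]), (fun=> x), 0, 0; split => //; split => // s t.
  rewrite /= !in_itv /= -!eq_le => /eqP <- /eqP <-.
  by rewrite (dP_refl hC hP w htheta)// subrr normr0.
have [c [F [Cc cx cy [FP iF] rF]]] := geodesic_through Px Py xy.
have [r _ rE] : range F x by rewrite rF.
have [s _ sE] : range F y by rewrite rF.
have [rs|/ltW sr] := leP r s.
  exists (F @` `[r, s]), F, r, s; split => //.
  by split => [t _|t t' _ _]; [exact: FP|exact: iF].
exists ((F \o -%R) @` `[- r, - s]), (F \o -%R), (- r), (- s); split => //=.
- by rewrite lerN2.
- split => [t _|t t' _ _] /=; first exact: FP.
  by rewrite iF// -opprD normrN.
- by rewrite opprK.
- by rewrite opprK.
Qed.

(** The right-hand side does not mention the segment, whence uniqueness. For the harder inclusion, z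
    and the point of the segment at the same distance from x both lie on the curve through x and y,
    which is isometric to a line, so they coincide. *)
Lemma geodesic_segment_eq x y S : P x -> P y -> geodesic_segment P d x y S ->
  S = [set z | P z /\ d x y = d x z + d z y].
Proof.
move=> Px Py [f [a [b [ab [fP fi] fa fb ->]]]].
have ia : `[a, b]%classic a by rewrite /= in_itv /= lexx.
have ib : `[a, b]%classic b by rewrite /= in_itv /= lexx ab.
have dxy : d x y = b - a by rewrite -fa -fb fi// distrC ger0_norm// subr_ge0.
have dx t : `[a, b]%classic t -> d x (f t) = t - a.
  move=> ht; rewrite -fa fi//; move: ht; rewrite /= in_itv /= => /andP[at_ _].
  by rewrite distrC ger0_norm// subr_ge0.
have dy t : `[a, b]%classic t -> d (f t) y = b - t.
  move=> ht; rewrite -fb fi//; move: ht; rewrite /= in_itv /= => /andP[_ tb].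
  by rewrite distrC ger0_norm// subr_ge0.
apply/seteqP; split => z.
  move=> [t ht <-]; split; first exact: fP.
  by rewrite dx// dy// dxy; lra.
move=> [Pz E].
have z1 := dP_ge0 hC hP htheta hw Px Pz; have z2 := dP_ge0 hC hP htheta hw Pz Py.
have [xy|xy] := pselect (x = y).
  have zE : z = x.
    apply/esym/(dP_eq0 hC hP htheta hw) => //; move: z2 E.
    rewrite -xy (dP_refl hC hP w htheta Px) => z2 /esym/eqP.
    by rewrite paddr_eq0// => /andP[/eqP].
  by exists a; rewrite // fa zE.
pose r := a + d x z.
have hr : `[a, b]%classic r by rewrite /= in_itv /= /r; lra.
exists r => //; have Pr := fP r hr.
have [c [F [Cc cx cy [FP iF] rF]]] := geodesic_through Px Py xy.
have cz := dP_collinear hC hP htheta hw Cc cx cy Px Py Pz xy E.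
have Er : d x y = d x (f r) + d (f r) y by rewrite dx// dy// dxy; lra.
have cr := dP_collinear hC hP htheta hw Cc cx cy Px Py Pr xy Er.
have [i0 _ e0] : range F x by rewrite rF.
have [i1 _ e1] : range F y by rewrite rF.
have [i2 _ e2] : range F z by rewrite rF.
have [i3 _ e3] : range F (f r) by rewrite rF.
have i01 : i0 != i1 by apply/eqP => Ei; apply: xy; rewrite -e0 -e1 Ei.
have drx : d x (f r) = d x z by rewrite dx// /r addrC addKr.
have dry : d (f r) y = d z y by rewrite dy//; move: E; rewrite dxy /r; lra.
rewrite -e2 -e3; congr F.
(* A point of the real line is determined by its distances to two distinct points: the difference of
   the squared equations is linear. *)
move: drx dry; rewrite -e0 -e1 -e2 -e3 !iF// => h1 h2.
have := congr1 (fun v : R => v ^+ 2) h1; have := congr1 (fun v : R => v ^+ 2) h2.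
rewrite /= !real_normK ?num_real// => q2 q1.
have : (i1 - i0) * (i3 - i2) = 0 by clear xy; lra.
move=> /eqP; rewrite mulf_eq0 subr_eq0 eq_sym (negbTE i01) /= subr_eq0.
by move/eqP.
Qed.

(** With [k = v - psi 0], the values at k and - k are among [psi 0 + k] and [psi 0 - k]. If neither
    is v they coincide, which forces k = 0. *)
Lemma isometry_surj (psi : R -> R) : (forall r s, `|psi r - psi s| = `|r - s|) ->
  forall v : R, exists r, psi r = v.
Proof.
move=> iso v; pose k := v - psi 0.
have h1 : psi k - psi 0 = k \/ psi k - psi 0 = - k.
  have /eqP := iso k 0; rewrite subr0 eqr_norm2 => /orP[/eqP|/eqP]; tauto.
have h2 : psi (- k) - psi 0 = k \/ psi (- k) - psi 0 = - k.
  have /eqP := iso (- k) 0; rewrite subr0 normrN eqr_norm2 => /orP[/eqP|/eqP]; tauto.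
case: h1 => h1; first by exists k; move: h1; rewrite /k; lra.
case: h2 => h2; first by exists (- k); move: h2; rewrite /k; lra.
have E : psi k = psi (- k) by lra.
have := iso k (- k); rewrite E subrr normr0 opprK => /esym/eqP; rewrite normr_eq0 => /eqP k0.
by exists 0; move: k0; rewrite /k => k0; lra.
Qed.

(** The points f 0 and f 1 determine the curve. For any other r, [dP_collinear] applies to the outer
    two of the three points and (C1) identifies the curves. In the coordinate F of the curve, f
    becomes an isometry of the real line, which is onto, so the curve is exhausted. *)
Lemma geodesic_iff S : is_geodesic P d S <->
  exists c, [/\ C c, c `&` P !=set0 & S = c `&` P].
Proof.
split; last first.
  move=> [c [Cc [x [cx Px]] ->]]; have [F iF rF] := geodesic_of_curve Cc cx Px.
  by exists F.
move=> [f [fP fi] ->].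
have dist r s : d (f r) (f s) = `|r - s| by exact: fi.
have fne r s : r != s -> f r <> f s.
  move=> rs E; have := dist r s; rewrite E (dP_refl hC hP w htheta); last exact: fP.
  by move=> /esym/eqP; rewrite normr_eq0 subr_eq0 (negbTE rs).
have three r s t : r < s -> s < t -> d (f r) (f t) = d (f r) (f s) + d (f s) (f t).
  by move=> rs st; rewrite !dist !ltr0_norm; lra.
have ne01 : f 0 <> f 1 by apply: fne; rewrite eq_sym oner_eq0.
have PP r : P (f r) by exact: fP.
have DD r : disk (f r) by exact: (polygon_disk hP).
have [c [F [Cc c0 c1 [FP iF] rF]]] := geodesic_through (PP 0) (PP 1) ne01.
have mem r : c (f r).
  have [r0|r0|->//] := ltgtP r 0.
    have nr : f r <> f 1 by apply: fne; rewrite lt_eqF//; lra.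
    have [c' [Cc' cr c1']] := curve_through hC (DD r) (DD 1) nr.
    have c0' := dP_collinear hC hP htheta hw Cc' cr c1' (PP r) (PP 1) (PP 0) nr
      (three _ _ _ r0 ltr01).
    by rewrite (curve_uniq hC Cc Cc' (DD 0) (DD 1) ne01).
  have [r1|r1|->//] := ltgtP r 1.
    exact: (dP_collinear hC hP htheta hw Cc c0 c1 (PP 0) (PP 1) (PP r) ne01 (three _ _ _ r0 r1)).
  have nr : f 0 <> f r by apply: fne; rewrite lt_eqF//; lra.
  have [c' [Cc' c0' cr]] := curve_through hC (DD 0) (DD r) nr.
  have c1' := dP_collinear hC hP htheta hw Cc' c0' cr (PP 0) (PP r) (PP 1) nr
    (three _ _ _ ltr01 r1).
  by rewrite (curve_uniq hC Cc Cc' (DD 0) (DD 1) ne01).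
exists c; split => //; first by exists (f 0).
have /choice[psi hpsi] : forall r, exists s, F s = f r.
  by move=> r; have [s _ sE] : range F (f r) by [rewrite rF]; exists s.
have iso r s : `|psi r - psi s| = `|r - s|.
  by rewrite -iF// !hpsi dist.
apply/seteqP; split => z; first by move=> [r _ <-]; split.
rewrite -rF => -[s _ <-]; have [r rE] := isometry_surj iso s.
by exists r => //; rewrite -hpsi rE.
Qed.

End GeodesicLines.

Theorem theorem8 (R : realType) (C : set (set (R * R))) (P : set (R * R))
    (sides : seq ((R * R) * (R * R))) (theta : nat -> R * R) (w : nat -> R)
    (hC : curve_family C)
    (hP : convex_polygon C P sides)
    (htheta : admissible_directions C sides theta)
    (hw : admissible_weights w) :
  [/\ (forall x y, P x -> P y -> cvgn (series (dterm C P theta w x y))) /\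
        is_metric_on P (dP C P theta w),
      geodesic_space P (dP C P theta w),
      [set S | is_geodesic P (dP C P theta w) S] =
        [set S | exists c, [/\ C c, c `&` P !=set0 & S = c `&` P]]
    & uniquely_geodesic P (dP C P theta w)].
Proof.
split.
- split; last exact: (dP_metric hC hP htheta hw).
  move=> x y Px Py; rewrite (dtermE hC hP w htheta)//; exact: (dist_term_cvg hC hP htheta hw).
- by move=> x y; exact: (geodesic_segment_ex hC hP htheta hw).
- by apply/seteqP; split => S /(geodesic_iff hC hP htheta hw).
move=> x y Px Py; have [S hS] := geodesic_segment_ex hC hP htheta hw Px Py.
exists S; split => // S' hS'.
by rewrite (geodesic_segment_eq hC hP htheta hw Px Py hS)
  (geodesic_segment_eq hC hP htheta hw Px Py hS').
Qed.
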